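(* Let $n \geq 1$, let $\mathbf{X} = \mathbb{R}^n$, and let $\alpha > 0$. Then there exists a polynomial $f \in \mathbb{R}[\mathbf{x}] = \mathbb{R}[x_1,\dots,x_n]$ that attains its minimum $f_{\min} = \min_{\mathbf{x} \in \mathbb{R}^n} f(\mathbf{x})$ on $\mathbb{R}^n$, but for which \[ \lim_{r \to \infty} \mathrm{ub}_\#(f,\Gamma_\alpha)_r > f_{\min}. \] In fact, for $n = 1$ one may take $f(x) = x^2 + x^{2\lceil \alpha \rceil + 2}$.
   Context: For $\alpha > 0$, $\Gamma_\alpha$ denotes the probability measure on $\mathbb{R}^n$ with density $w_\alpha(\mathbf{x}) = C_\alpha \exp\left(-\sum_{i=1}^n |x_i|^\alpha\right)$ with respect to the Lebesgue measure on $\mathbb{R}^n$, where $C_\alpha > 0$ is the normalizing constant. All its moments are finite. For $r \in \mathbb{N}$, $\Sigma[x]_{2r}$ denotes the cone of univariate sums of squares $p_1^2 + \dots + p_\ell^2$ of polynomials $p_i \in \mathbb{R}[x]$ of degree at most $r$. For a polynomial $f \in \mathbb{R}[\mathbf{x}]$, a finite Borel measure $\mu$ on $\mathbb{R}^n$ with finite moments, and $r \in \mathbb{N}$, define the push-forward bound \[ \mathrm{ub}_\#(f,\mu)_r := \min_{s \in \Sigma[x]_{2r}} \left\{ \int_{\mathbb{R}^n} f(\mathbf{x})\, s(f(\mathbf{x}))\, d\mu(\mathbf{x}) : \int_{\mathbb{R}^n} s(f(\mathbf{x}))\, d\mu(\mathbf{x}) = 1 \right\}, \] where the optimization is over univariate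 sums of squares $s$. This sequence is non-increasing in $r$ and, when $f$ attains its minimum $f_{\min}$ on $\mathbb{R}^n$, satisfies $\mathrm{ub}_\#(f,\mu)_r \geq f_{\min}$. *)

(* Defs.v *)
From HB Require Import structures.
From mathcomp Require Import all_boot all_order all_algebra.
From mathcomp Require Import all_classical all_reals all_analysis.
From mathcomp Require Import measurable_realfun.
From mathcomp.multinomials Require mpoly.
(* Only the structures on [mpoly.mpoly n R] are imported: the notations of
   mpoly clash with those of the analysis library. *)
Import (canonicals) mpoly.

Set Implicit Arguments.
Unset Strict Implicit.
Unset Printing Implicit Defensive.

Import Order.TTheory GRing.Theory Num.Theory.
Import numFieldNormedType.Exports.

Local Open Scope classical_set_scope.
Local Open Scope ring_scope.

Notation Rn R n := (n.-tuple R).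

Section lebesgue_Rn.
Context {R : realType}.

Definition Rn_cons n (x : R * Rn R n) : Rn R n.+1 :=
  [tuple of x.1 :: x.2].

Definition Rn_uncons n (t : Rn R n.+1) : R * Rn R n :=
  (thead t, [tuple of behead t]).

Lemma Rn_consK n : cancel (@Rn_cons n) (@Rn_uncons n).
Proof. by case=> x t; rewrite /Rn_uncons/= theadE; congr pair; exact: val_inj. Qed.

Lemma measurable_Rn_cons n : measurable_fun setT (@Rn_cons n).
Proof. exact: measurable_cons. Qed.

Lemma measurable_Rn_uncons n : measurable_fun setT (@Rn_uncons n).
Proof.
apply: measurable_fun_pair; first exact: measurable_tnth.
exact: measurable_behead.
Qed.

(* [lebesgue_prod m] is the product of the Lebesgue measure on [R] and [m],
   carried by the identification of [R * R^n] with [R^(n+1)]. *)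
Definition lebesgue_prod n (m : set (Rn R n) -> \bar R) : set (Rn R n.+1) -> \bar R :=
  pushforward (@lebesgue_measure R \x m)%E (@Rn_cons n).

Section lebesgue_prod_measure.
Context n (m : {sigma_finite_measure set (Rn R n) -> \bar R}).
Local Notation nu := (lebesgue_prod m).

Let nu0 : nu set0 = 0%E.
Proof. by rewrite /lebesgue_prod /pushforward preimage_set0 measure0. Qed.

Let nu_ge0 A : (0 <= nu A)%E.
Proof. by rewrite /lebesgue_prod /pushforward measure_ge0. Qed.

Let nu_sigma_additive : semi_sigma_additive nu.
Proof.
exact: (@measure_semi_sigma_additive _ _ _
  (measure_function_pushforward__canonical__measure_function_Measure
    (@lebesgue_measure R \x m)%E (@measurable_Rn_cons n))).
Qed.

HB.instance Definition _ := isMeasure.Build _ _ _ nu nu0 nu_ge0 nu_sigma_additive.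

Let nu_sigma_finite : sigma_finite setT nu.
Proof.
have /sigma_finiteP[F [TF ndF Foo]] := sigma_finiteT (@lebesgue_measure R).
have /sigma_finiteP[G [TG ndG Goo]] := sigma_finiteT m.
exists (fun k => @Rn_uncons n @^-1` (F k `*` G k)) => [|k].
  apply/seteqP; split => // t _.
  have [i _ Fi] : (\bigcup_i F i) (Rn_uncons t).1 by rewrite -TF.
  have [j _ Gj] : (\bigcup_i G i) (Rn_uncons t).2 by rewrite -TG.
  exists (maxn i j) => //; split.
    by move: Fi; exact/subsetPset/ndF/leq_maxl.
  by move: Gj; exact/subsetPset/ndG/leq_maxr.
have [mF Fy] := Foo k; have [mG Gy] := Goo k; split.
  rewrite -[X in measurable X]setTI; apply: measurable_Rn_uncons => //.
  exact: measurableX.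
rewrite /lebesgue_prod /pushforward -comp_preimage.
rewrite (_ : _ \o _ = id); last exact/funext/Rn_consK.
by rewrite preimage_id product_measure1E// lte_mul_pinfty// ge0_fin_numE.
Qed.

HB.instance Definition _ := Measure_isSigmaFinite.Build _ _ _ nu nu_sigma_finite.

End lebesgue_prod_measure.

Fixpoint lebesgue_Rn n : {sigma_finite_measure set (Rn R n) -> \bar R} :=
  if n is k.+1 then lebesgue_prod (lebesgue_Rn k) else dirac [tuple].

End lebesgue_Rn.

Section exponential_power.
Context {R : realType} (alpha : R) (n : nat).

Definition Gamma_weight (x : Rn R n) : R :=
  expR (- \sum_(i < n) `|tnth x i| `^ alpha).

Definition Gamma_const : R :=
  (fine (\int[lebesgue_Rn n]_x (Gamma_weight x)%:E)%E)^-1.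

Definition Gamma_density (x : Rn R n) : R := Gamma_const * Gamma_weight x.

Definition Gamma (A : set (Rn R n)) : \bar R :=
  (\int[lebesgue_Rn n]_(x in A) (Gamma_density x)%:E)%E.

Lemma Gamma_weight_ge0 x : 0 <= Gamma_weight x. Proof. exact: expR_ge0. Qed.

Lemma Gamma_const_ge0 : 0 <= Gamma_const.
Proof.
rewrite invr_ge0 fine_ge0// integral_ge0// => x _.
by rewrite lee_fin Gamma_weight_ge0.
Qed.

Lemma Gamma_density_ge0 x : 0 <= Gamma_density x.
Proof. by rewrite mulr_ge0 ?Gamma_const_ge0 ?Gamma_weight_ge0. Qed.

Lemma measurable_Gamma_weight : measurable_fun setT Gamma_weight.
Proof.
apply: measurableT_comp => //; apply: measurableT_comp => //.
apply: measurable_sum => i; apply: (measurableT_comp (measurable_powR alpha)).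
apply: measurableT_comp => //; exact: measurable_tnth.
Qed.

Lemma measurable_Gamma_density : measurable_fun setT Gamma_density.
Proof. by apply: measurable_funM => //; exact: measurable_Gamma_weight. Qed.

Let Gamma0 : Gamma set0 = 0%E. Proof. exact: integral_set0. Qed.

Let Gamma_ge0 A : (0 <= Gamma A)%E.
Proof. by apply: integral_ge0 => x _; rewrite lee_fin Gamma_density_ge0. Qed.

Let Gamma_sigma_additive : semi_sigma_additive Gamma.
Proof.
apply: semi_sigma_additive_nng_induced => [|x].
  by apply/measurable_EFinP; exact: measurable_Gamma_density.
by rewrite lee_fin Gamma_density_ge0.
Qed.

HB.instance Definition _ := isMeasure.Build _ _ _ Gamma
  Gamma0 Gamma_ge0 Gamma_sigma_additive.

End exponential_power.

Section Gamma_probability.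
Context {R : realType} (alpha : R) (alpha_gt0 : 0 < alpha).
Local Notation mu := (@lebesgue_measure R).

Let w1 (t : R) : R := expR (- (`|t| `^ alpha)).

Let mw1 : measurable_fun setT w1.
Proof.
apply: measurableT_comp => //; apply: measurableT_comp => //.
apply: (measurableT_comp (measurable_powR alpha)).
exact: normr_measurable.
Qed.

Let w1_le : exists2 K : R, 0 <= K & forall t, w1 t <= K * (oneDsqr t)^-1.
Proof.
pose k := Num.truncn (2 / alpha).
have k2 : 2 <= alpha * k.+1%:R.
  by rewrite mulrC -ler_pdivrMr// ltW// truncnS_gt.
exists (2 * (k.+1)`!%:R) => [|t]; first by rewrite mulr_ge0.
have f1 : (1 : R) <= (k.+1)`!%:R by rewrite ler1n fact_gt0.
have D0 : 0 < oneDsqr t by rewrite (lt_le_trans ltr01)// oneDsqr_ge1.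
rewrite ler_pdivlMr//.
have [t1|t1] := leP `|t| 1.
  rewrite (@le_trans _ _ (1 * 2))//; last by rewrite mul1r ler_peMr.
  rewrite ler_pM ?expR_ge0 ?(ltW D0)//.
    by rewrite /w1 expR_le1 oppr_le0 powR_ge0.
  by rewrite /oneDsqr -[t ^+ 2]ger0_norm ?sqr_ge0// normrX mulr2n lerD2l exprn_ile1.
have t0 : 0 < `|t| by rewrite (lt_trans _ t1).
rewrite /w1 expRN mulrC ler_pdivrMr ?expR_gt0//.
have := expR_ge1Dxn k (powR_ge0 `|t| alpha).
set e := expR _ => He.
have : (`|t| `^ alpha) ^+ k.+1 <= (k.+1)`!%:R * e.
  rewrite mulrC -ler_pdivrMr ?(lt_le_trans ltr01)//.
  by rewrite (le_trans _ He)// lerDr.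
have : oneDsqr t <= 2 * (`|t| `^ alpha) ^+ k.+1.
  rewrite -powR_mulrn ?powR_ge0// -powRrM.
  apply: (@le_trans _ _ (2 * `|t| ^+ 2)).
    rewrite /oneDsqr -[t ^+ 2]ger0_norm ?sqr_ge0// normrX mulr2n mulrDl mul1r.
    by rewrite lerD2r expr_ge1// ltW.
  by rewrite ler_pM2l// -powR_mulrn ?(ltW t0)// ler_powR// ltW.
move=> h1 h2; rewrite (le_trans h1)// -mulrA ler_pM2l//.
Qed.

Let I1 := (\int[mu]_t (w1 t)%:E)%E.

Let w1_ge0 t : (0 <= (w1 t)%:E)%E.
Proof. by rewrite lee_fin expR_ge0. Qed.

Let I1_gt0 : (0 < I1)%E.
Proof.
apply: (@lt_le_trans _ _ (\int[mu]_(t in `[0%R, 1%R]) (expR (-1))%:E)%E).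
  rewrite integral_cst//= lebesgue_measure_itv/= lte01 oppr0 adde0 mule1.
  by rewrite lte_fin expR_gt0.
apply: (@le_trans _ _ (\int[mu]_(t in `[0%R, 1%R]) (w1 t)%:E)%E).
  apply: ge0_le_integral => //.
  - by apply: measurable_funTS; apply/measurable_EFinP.
  - move=> t /=; rewrite in_itv/= => /andP[t0 t1].
    rewrite lee_fin ler_expR lerN2 (_ : 1 = 1 `^ alpha); last by rewrite powR1.
    by rewrite ge0_ler_powR ?nnegrE ?(ltW alpha_gt0)// ger0_norm.
apply: ge0_subset_integral => //.
by apply/measurable_EFinP.
Qed.

Let I1_lty : (I1 < +oo)%E.
Proof.
have [K K0 wK] := w1_le.
have moneV : measurable_fun setT (fun t : R => (oneDsqr t)^-1).
  by apply: continuous_measurable_fun; exact: continuous_oneDsqrV.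
have oneV_ge0 t : 0 <= (oneDsqr (t : R))^-1.
  by rewrite invr_ge0 (le_trans ler01)// oneDsqr_ge1.
apply: (@le_lt_trans _ _ (\int[mu]_t (K%:E * ((oneDsqr t)^-1)%:E))%E).
  apply: ge0_le_integral => //.
  - by apply/measurable_EFinP.
  - by apply: measurable_funeM; apply/measurable_EFinP.
  - by move=> t _; rewrite -EFinM lee_fin.
rewrite ge0_integralZl//; last by apply/measurable_EFinP.
rewrite ge0_symfun_integralT//; last 2 first.
- exact: continuous_oneDsqrV.
- by move=> t /=; rewrite /oneDsqr sqrrN.
rewrite (_ : [set x | _] = `[0%R, +oo[%classic); last first.
  by apply/seteqP; split => x /=; rewrite in_itv/= andbT.
by rewrite integral0y_oneDsqr -!EFinM ltry.
Qed.

Let W n := (\int[lebesgue_Rn n]_x (Gamma_weight alpha x)%:E)%E.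

Let W0 : W 0 = 1%E.
Proof.
rewrite /W integral_dirac//; first by rewrite diracT mul1e /Gamma_weight big_ord0 oppr0 expR0.
by apply/measurable_EFinP; exact: measurable_Gamma_weight.
Qed.

Let WS n : W n.+1 = (I1 * W n)%E.
Proof.
have mE : measurable_fun setT (fun x : Rn R n.+1 => (Gamma_weight alpha x)%:E).
  by apply/measurable_EFinP; exact: measurable_Gamma_weight.
transitivity (\int[mu \x lebesgue_Rn n]_z (Gamma_weight alpha (Rn_cons z))%:E)%E.
  have w0 : {in setT, forall x : Rn R n.+1, (0 <= (Gamma_weight alpha x)%:E)%E}.
    by move=> x _; rewrite lee_fin Gamma_weight_ge0.
  have := @ge0_integral_pushforward _ _ (measurableTypeR R * Rn R n)%type _ _ _
    (@measurable_Rn_cons R n) (mu \x lebesgue_Rn n)%E _ _ measurableT mE w0.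
  by rewrite preimage_setT.
rewrite fubini_tonelli1//; last 2 first.
- exact: (measurableT_comp mE (@measurable_Rn_cons R n)).
- by move=> z; rewrite lee_fin Gamma_weight_ge0.
rewrite /fubini_F.
transitivity (\int[mu]_t ((w1 t)%:E * W n))%E.
  apply: eq_integral => t _.
  rewrite /W -ge0_integralZl//; last 2 first.
  - by apply/measurable_EFinP; exact: measurable_Gamma_weight.
  - by move=> x _; rewrite lee_fin Gamma_weight_ge0.
  apply: eq_integral => x _; rewrite -EFinM -expRD /Gamma_weight big_ord_recl opprD.
  by congr (expR (_ - _))%:E; apply: eq_bigr => i _; rewrite tnthS.
rewrite ge0_integralZr//; first exact/measurable_EFinP.
by apply: integral_ge0 => x _; rewrite lee_fin Gamma_weight_ge0.
Qed.

Let W_gt0_lty n : (0 < W n < +oo)%E.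
Proof.
elim: n => [|n /andP[IH0 IHy]]; first by rewrite W0 lte01 ltry.
by rewrite WS mule_gt0// lte_mul_pinfty// ?ltW// ge0_fin_numE// ltW.
Qed.

(* In particular the integral in [Gamma_const] is finite and nonzero. *)
Lemma Gamma_setT n : Gamma alpha [set: Rn R n] = 1%E.
Proof.
have /andP[W0' Wy] := W_gt0_lty n.
have Wfin : W n \is a fin_num by rewrite ge0_fin_numE// ltW.
rewrite /Gamma /Gamma_density; under eq_integral do rewrite EFinM.
rewrite ge0_integralZl//; last 3 first.
- by apply/measurable_EFinP; exact: measurable_Gamma_weight.
- by move=> x _; rewrite lee_fin Gamma_weight_ge0.
- by rewrite lee_fin Gamma_const_ge0.
rewrite -/(W n) -(fineK Wfin) -EFinM /Gamma_const -/(W n) mulVf//.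
by rewrite gt_eqF// fine_gt0// W0'.
Qed.

End Gamma_probability.

Section pushforward_bound.
Context {R : realType}.
Implicit Types (s : {poly R}) (r : nat).

Definition sos r : set {poly R} :=
  [set s | exists ps : seq {poly R},
     all (fun p : {poly R} => size p <= r.+1)%N ps /\ s = \sum_(p <- ps) p ^+ 2].

Definition mpoly_fun n (f : mpoly.mpoly n R) (x : Rn R n) : R :=
  mpoly.meval (tnth x) f.

(* The minimum over [s] is rendered as an infimum in the extended reals, so
   that it is defined for every [f] and [mu]. *)
Definition ub_push n (f : mpoly.mpoly n R) (mu : {measure set (Rn R n) -> \bar R})
    r : \bar R :=
  ereal_inf [set (\int[mu]_x (mpoly_fun f x * s.[mpoly_fun f x])%:E)%E | s in
    [set s | sos r s /\ (\int[mu]_x (s.[mpoly_fun f x])%:E = 1)%E]].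

Definition is_minimum T (g : T -> R) (m : R) :=
  (exists x, g x = m) /\ forall x, m <= g x.

End pushforward_bound.

(* Main.v *)
Require Import Defs.
From HB Require Import structures.
From mathcomp Require Import all_boot all_order all_algebra.
From mathcomp Require Import all_classical all_reals all_analysis.
From mathcomp Require Import measurable_realfun ring lra.
From mathcomp.multinomials Require mpoly.
From mathcomp Require complex.
Import (canonicals) mpoly.
Import (canonicals) complex.

(* Idea. With f = x_0^2 + x_0^(2m+2) and alpha < m + 1, the law of f under
   Gamma_alpha has tail exp(- t^gamma) with gamma = alpha / (2m+2) < 1/2, which
   is heavy enough for point evaluation at t0 in [0, 1] to be controlled by the
   law on [2, +oo[ only: q(t0) <= C * int q(f) dGamma_alpha for every polynomial
   q >= 0 on [0, +oo[. Hence if int s(f) dGamma_alpha = 1, then s <= C near 0,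
   so a neighbourhood of {f = 0} carries at most half of the mass of
   s(f) dGamma_alpha, and int f s(f) dGamma_alpha stays away from 0.

   For the evaluation bound, put t = 2 + h u^2 with h = 2 - t0, so that u = i
   corresponds to t = t0, and apply the Poisson formula to the rational function
   S(s) / prod_(k < N) (1 - a_k s), where s = i u, S(s) = s q(2 - h s^2) and
   a_k > 0. By partial fractions this only needs the integral of
   1 / ((1 + a^2 u^2) (1 + u^2)). On s = i u the modulus of the denominator is
   prod_k sqrt(1 + a_k^2 u^2), while its value at s = -1 is at most
   exp (sum_k a_k). Choosing a_k proportional to (k+1)^(-1/b) with
   b = 2 gamma < 1 makes the sum finite and, as N tends to infinity, the product
   at least of order exp (t^gamma). *)

Set Implicit Arguments.
Unset Strict Implicit.
Unset Printing Implicit Defensive.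

Import Order.TTheory GRing.Theory Num.Theory.
Import numFieldNormedType.Exports.

Local Open Scope classical_set_scope.
Local Open Scope ring_scope.

(** * The Poisson formula for rational functions *)

Section half_line.
Context {R : realType}.
Local Notation mu := (@lebesgue_measure R).
Local Notation H := (`[0%R, +oo[%classic : set R).

(** Integrability is kept together with the value: the integrands of the Poisson formula may change
    sign, and linearity of the integral needs it. *)
Definition has_integral (f : R -> R) (c : R) :=
  mu.-integrable H (EFin \o f) /\ (\int[mu]_(u in H) (f u)%:E = c%:E)%E.

Lemma has_integralD f g c d :
  has_integral f c -> has_integral g d -> has_integral (f \+ g) (c + d).
Proof.
move=> [f1 f2] [g1 g2]; split.
  rewrite (_ : EFin \o _ = (EFin \o f) \+ (EFin \o g))%E//.
  exact: integrableD.
rewrite EFinD -f2 -g2 -integralD_EFin//.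
Qed.

Lemma has_integralZ k f c :
  has_integral f c -> has_integral (fun u => k * f u) (k * c).
Proof.
move=> [f1 f2]; split.
  rewrite (_ : EFin \o _ = (fun u => k%:E * (EFin \o f) u))%E//.
  exact: integrableZl.
rewrite EFinM -f2 -integralZl//.
Qed.

Lemma eq_has_integral {f} g {c} :
  (forall u, f u = g u) -> has_integral f c -> has_integral g c.
Proof. by move=> /funext ->. Qed.

Lemma ge0_has_integral (f : R -> R) (c : R) : measurable_fun H f -> (forall u, 0 <= f u) ->
  (\int[mu]_(u in H) (f u)%:E = c%:E)%E -> has_integral f c.
Proof.
move=> mf f0 fc; split=> //; apply/integrableP; split.
  exact/measurable_EFinP.
by under eq_integral do rewrite /= ger0_norm//; rewrite fc ltry.
Qed.

Lemma continuous_atan_dilation (a : R) : continuous (fun u : R => atan (a * u)).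
Proof.
move=> u; apply: (@continuous_comp _ _ _ (fun u => a * u)).
  exact: mulrl_continuous.
exact: continuous_atan.
Qed.

Lemma continuous_lorentz (a : R) : continuous (fun u : R => a / (1 + (a * u) ^+ 2)).
Proof.
move=> u; apply: cvgM; first exact: cvg_cst.
apply: (@continuous_comp _ _ _ (fun u : R => a * u) (fun x => (1 + x ^+ 2)^-1)).
  exact: mulrl_continuous.
exact: continuous_oneDsqrV.
Qed.

Lemma has_integral_lorentz (a : R) : 0 < a ->
  has_integral (fun u => a / (1 + (a * u) ^+ 2)) (pi / 2).
Proof.
move=> a0; apply: ge0_has_integral.
- apply: measurable_funTS; apply: continuous_measurable_fun.
  exact: continuous_lorentz.
- by move=> u; rewrite divr_ge0 ?(ltW a0)// addr_ge0 ?sqr_ge0.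
rewrite (@ge0_continuous_FTC2y _ _ (fun u => atan (a * u)) _ (pi / 2)).
- by rewrite mulr0 atan0 sube0.
- by move=> u _; rewrite divr_ge0 ?(ltW a0)// addr_ge0 ?sqr_ge0.
- apply: continuous_subspaceT; exact: continuous_lorentz.
- apply: (@cvg_comp _ _ _ (fun u : R => a * u) atan _ +oo%R); last exact: cvgy_atan.
  by apply: gt0_cvgMry => //; exact: cvg_id.
- by move=> u _; apply: ex_derive.
- by apply: cvg_at_right_filter; exact: continuous_atan_dilation.
- move=> u _; rewrite derive1E.
  have H : is_derive u 1 (fun u => atan (a * u)) (a / (1 + (a * u) ^+ 2)).
    apply: (is_derive_eq (is_derive1_comp (f := atan) (g := fun u => a * u) _ _)).
    by rewrite /GRing.scale/= mulr1 mulrC.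
  exact: derive_val.
Qed.

(** Partial fractions in u^2 reduce this to the integrals of 1/(1 + u^2) and a/(1 + a^2 u^2), both
    equal to pi/2; [a != 1] keeps the two factors distinct. *)
Lemma has_integral_poisson (a : R) : 0 < a -> a != 1 ->
  has_integral (fun u => ((1 + (a * u) ^+ 2) * (1 + u ^+ 2))^-1) (pi / 2 / (1 + a)).
Proof.
move=> a0 a1.
have h1 := has_integralZ (1 - a ^+ 2)^-1 (has_integral_lorentz ltr01).
have h2 := has_integralZ (- (a / (1 - a ^+ 2))) (has_integral_lorentz a0).
have na : 1 - a ^+ 2 != 0.
  rewrite subr_eq0 eq_sym sqrf_eq1 negb_or a1/=.
  by rewrite gt_eqF// (lt_trans _ a0)// ltrN10.
have -> : pi / 2 / (1 + a) =
    (1 - a ^+ 2)^-1 * (pi / 2) + - (a / (1 - a ^+ 2)) * (pi / 2) :> R.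
  by field; rewrite na; apply/andP; split=> //; rewrite gt_eqF// addr_gt0.
apply: eq_has_integral (has_integralD h1 h2) => u /=.
have p1 : 1 + u ^+ 2 != 0 :> R by rewrite gt_eqF// ltr_pwDl ?sqr_ge0.
have p2 : 1 + (a * u) ^+ 2 != 0 :> R by rewrite gt_eqF// ltr_pwDl ?sqr_ge0.
rewrite mul1r; field.
by rewrite na p1 p2.
Qed.

End half_line.

Section poisson.
Context {R : realType}.
Import complex.
Local Notation C := (complex R).
Local Notation rc := (real_complex R).

Definition cprod (l : seq R) (s : C) : C := \prod_(a <- l) (1 - rc a * s).

(* The boundary u |-> i u of the left half-plane is folded onto u >= 0, which is
   harmless for the real part of a function with real coefficients. *)
Definition poisson (g : C -> C) :=
  has_integral (fun u : R => Re (g (Complex 0 u)) / (1 + u ^+ 2)) (pi / 2 * Re (g (-1))).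

Lemma ReD (x y : C) : Re (x + y) = Re x + Re y. Proof. by case: x y => [? ?] []. Qed.

Lemma ReZ k (x : C) : Re (rc k * x) = k * Re x.
Proof. by case: x => a b /=; rewrite mul0r subr0. Qed.

Lemma poissonD g h : poisson g -> poisson h -> poisson (g \+ h).
Proof.
move=> pg ph; rewrite /poisson /= ReD mulrDr.
by apply: eq_has_integral (has_integralD pg ph) => u /=; rewrite ReD mulrDl.
Qed.

Lemma poissonZ k g : poisson g -> poisson (fun s => rc k * g s).
Proof.
move=> pg; rewrite /poisson ReZ mulrCA.
by apply: eq_has_integral (has_integralZ k pg) => u /=; rewrite ReZ mulrA.
Qed.

(** The formula only looks at the points i u and -1, all in the closed left half-plane, where the
    denominators used below do not vanish. *)
Lemma eq_poisson g h : (forall s : C, Re s <= 0 -> g s = h s) -> poisson g -> poisson h.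
Proof.
move=> gh; rewrite /poisson gh; last by rewrite /= oppr_le0.
by apply: eq_has_integral => u; rewrite gh.
Qed.

Lemma cfactor_neq0 (a : R) (s : C) : 0 < a -> Re s <= 0 -> 1 - rc a * s != 0.
Proof.
move=> a0; case: s => x y /= x0; rewrite eq_complex /= negb_and.
rewrite gt_eqF// mul0r subr0 subr_gt0.
by rewrite (le_lt_trans _ ltr01)// mulr_ge0_le0// ltW.
Qed.

Lemma cprod_neq0 l (s : C) : all (fun a => 0 < a) l -> Re s <= 0 -> cprod l s != 0.
Proof.
move=> l0 s0; rewrite /cprod; elim: l l0 => [_|a l IH /= /andP[a0 l0]].
  by rewrite big_nil oner_eq0.
by rewrite big_cons mulf_neq0 ?cfactor_neq0 ?IH.
Qed.

Lemma cprod_cons a l s : cprod (a :: l) s = (1 - rc a * s) * cprod l s.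
Proof. by rewrite /cprod big_cons. Qed.

(** Induction on the number of poles, by 1/((1 - a s)(1 - b s)) = (a/(1 - a s) - b/(1 - b s))/(a -
    b). For a single pole, the real part of 1/(1 - i a u) is 1/(1 + a^2 u^2). *)
Lemma poisson_inv l : uniq l -> all (fun a => (0 < a) && (a != 1)) l -> l != [::] ->
  poisson (fun s => (cprod l s)^-1).
Proof.
have [n] := ubnP (size l); elim: n l => // n IH [//|a [|b l]] sl.
  move=> _ /= /andP[/andP[a0 a1] _] _.
  apply: (@eq_poisson (fun s => (1 - rc a * s)^-1)).
    by move=> s _; rewrite /cprod big_seq1.
  rewrite /poisson.
  have -> : Re (1 - rc a * -1)^-1 = (1 + a)^-1.
    by rewrite mulrN1 opprK -[1](rmorph1 rc) -rmorphD -fmorphV.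
  apply: eq_has_integral (has_integral_poisson a0 a1) => u.
  rewrite invfM; congr (_ / _).
  rewrite /= !mul0r addr0 mulr0 !subr0 expr1n add0r sqrrN.
  by rewrite mul1r.
move=> /= /andP[/norP[ab al] /andP[bl ul]] /and3P[a0 b0 l0] _.
have ab0 : rc (a - b) != 0.
  by rewrite fmorph_eq0 subr_eq0.
have pos m : all (fun a => (0 < a) && (a != 1)) m -> all (fun a : R => 0 < a) m.
  by apply: sub_all => x /andP[].
apply: (@eq_poisson (fun s => rc (a - b)^-1 *
    (rc a * (cprod (a :: l) s)^-1 + rc (- b) * (cprod (b :: l) s)^-1))).
  move=> s s0; rewrite !cprod_cons.
  have := cprod_neq0 (pos _ l0) s0; set q := cprod l s => q0.
  have ha : 1 - rc a * s != 0 by rewrite cfactor_neq0//; case/andP: a0.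
  have hb : 1 - rc b * s != 0 by rewrite cfactor_neq0//; case/andP: b0.
  rewrite fmorphV rmorphN; rewrite !rmorphB /= in ab0 *.
  by field; rewrite ha hb q0 ab0.
apply/poissonZ/poissonD; apply: poissonZ; apply: IH => //=.
- by rewrite al.
- by rewrite a0.
- by rewrite bl.
- by rewrite b0.
Qed.

(** Division by 1 - a s with remainder c = S(1/a): it cancels one factor of a denominator while
    lowering the degree of the numerator. *)
Lemma poly_inv_root_split (a : R) (S : {poly R}) n : a != 0 -> (size S <= n.+1)%N ->
  exists c S', (size (S' : {poly R}) <= n)%N /\
   forall s : C, (map_poly rc S).[s] = rc c + (1 - rc a * s) * (map_poly rc S').[s].
Proof.
move=> a0 sS; pose c := S.[a^-1].
have /factor_theorem [T hT] : root (S - c%:P) a^-1 by rewrite rootE !hornerE subrr.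
exists c, (- a^-1 *: T); split.
  rewrite size_scale ?oppr_eq0 ?invr_eq0//.
  have [->|T0] := eqVneq T 0; first by rewrite size_poly0.
  have := size_Mmonic T0 (monicXsubC a^-1); rewrite size_XsubC addn2/= => sT.
  rewrite -ltnS -sT -hT (leq_trans (size_polyD _ _))// geq_max sS size_polyN.
  by rewrite (leq_trans (size_polyC_leq1 _)).
move=> s; have -> : S = c%:P + T * ('X - a^-1%:P) by rewrite -hT addrC subrK.
rewrite rmorphD/= rmorphM/= rmorphB/= !map_polyC/= map_polyX map_polyZ/= !hornerE/=.
rewrite rmorphN fmorphV/=; field.
by rewrite fmorph_eq0.
Qed.

(** The numerator has smaller degree than the denominator, so repeated division leaves only
    constants over products of linear factors, which [poisson_inv] covers. *)
Lemma poisson_ratio l (S : {poly R}) :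
  uniq l -> all (fun a => (0 < a) && (a != 1)) l -> (size S <= size l)%N ->
  poisson (fun s => (map_poly rc S).[s] / cprod l s).
Proof.
elim: l S => [|a l IH] S ul l0.
  rewrite leqn0 size_poly_eq0 => /eqP ->.
  (* Without poles S = 0, and the zero function is reached as 0 times any function known to satisfy
     the formula. *)
  have [g pg] : exists g, poisson g.
    exists (fun s => (cprod [:: 2] s)^-1); apply: poisson_inv => //=.
    by rewrite ltr0n gt_eqF// ltr1n.
  apply: eq_poisson (poissonZ 0 pg) => s _.
  by rewrite map_poly0 horner0 !mul0r.
move=> sS; have /= /andP[/andP[a0 a1] l0'] := l0.
have [|c [S' [sS' ES]]] := @poly_inv_root_split a S (size l) _ sS; first by rewrite gt_eqF.
have pi := poisson_inv ul l0 isT; have /= /andP[_ ul'] := ul.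
have pS := IH _ ul' l0' sS'.
apply: eq_poisson (poissonD (poissonZ c pi) pS) => s s0 /=.
rewrite ES cprod_cons; have /= q0 : cprod l s != 0.
  by apply: cprod_neq0 => //; apply: sub_all l0' => x /andP[].
have ha := cfactor_neq0 a0 s0.
by field; rewrite ha q0.
Qed.

End poisson.

(** * The evaluation bound for infinitely many poles *)

Section evaluation_bound.
Context {R : realType}.
Import complex.
Local Notation mu := (@lebesgue_measure R).
Local Notation H := (`[0%R, +oo[%classic : set R).
Local Notation C := (complex R).
Local Notation rc := (real_complex R).

(** The modulus of [cprod l] at i u. *)
Definition rprod (l : seq R) (u : R) : R := \prod_(a <- l) Num.sqrt (1 + (a * u) ^+ 2).

Lemma rfactor_ge1 (a u : R) : 1 <= Num.sqrt (1 + (a * u) ^+ 2).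
Proof. by rewrite -[leLHS]sqrtr1 ler_wsqrtr// lerDl sqr_ge0. Qed.

Lemma rprod_ge1 l u : 1 <= rprod l u.
Proof.
rewrite /rprod; elim: l => [|a l IH]; first by rewrite big_nil.
by rewrite big_cons -[leLHS]mulr1 ler_pM// rfactor_ge1.
Qed.

Lemma rprod_gt0 l u : 0 < rprod l u.
Proof. exact: lt_le_trans ltr01 (rprod_ge1 l u). Qed.

Lemma normc_cprod l (u : R) : Normc.normc (cprod l (Complex 0 u)) = rprod l u.
Proof.
rewrite /rprod; elim: l => [|a l IH].
  by rewrite /cprod !big_nil Normc.normc1.
rewrite cprod_cons Normc.normcM IH big_cons; congr (_ * _) => /=.
by rewrite !mul0r mulr0 !subr0 addr0 expr1n sub0r sqrrN.
Qed.

Lemma Re_le_normc (z : C) : `|Re z| <= Normc.normc z.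
Proof.
case: z => x y /=; rewrite -sqrtr_sqr ler_wsqrtr// lerDl sqr_ge0//.
Qed.

Lemma normc_le_add (x y : C) : Normc.normc (x + y) <= Normc.normc x + Normc.normc y.
Proof. by have := ler_normD x y; rewrite -lecR rmorphD. Qed.

(** The same repeated division as in [poisson_ratio]. The constant D yields the integrable majorant
    D/(1 + u^2) when the number of poles tends to infinity. *)
Lemma bounded_ratio l (S : {poly R}) : all (fun a => 0 < a) l ->
  (size S <= size l)%N ->
  exists2 D, 0 <= D &
    forall u, Normc.normc (map_poly rc S).[Complex 0 u] <= D * rprod l u.
Proof.
elim: l S => [|a l IH] S l0.
  rewrite leqn0 size_poly_eq0 => /eqP ->; exists 0 => // u.
  by rewrite map_poly0 horner0 Normc.normc0 mul0r.
move: l0 => /= /andP[a0 l0] sS.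
have [|c [T [sT ES]]] := @poly_inv_root_split _ a S (size l) _ sS; first by rewrite gt_eqF.
have [D D0 hD] := IH T l0 sT.
exists (`|c| + D) => [|u]; first by rewrite addr_ge0.
rewrite ES (le_trans (normc_le_add _ _))// [leRHS]mulrDl lerD//.
  by rewrite /= expr0n addr0 sqrtr_sqr ler_peMr// rprod_ge1.
rewrite Normc.normcM.
have := normc_cprod [:: a] u; rewrite /cprod /rprod !big_seq1 big_cons => ->.
by rewrite mulrCA ler_wpM2l// sqrtr_ge0.
Qed.

(* The factor 'X turns du into dt up to a constant; without it the density of the
   image measure in t would be singular at t = 2. *)
Definition evenized (q : {poly R}) (h : R) : {poly R} :=
  'X * (q \Po (2%:P - h *: 'X^2)).

Lemma normc_evenized q h (u : R) : 0 <= u ->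
  Normc.normc (map_poly rc (evenized q h)).[Complex 0 u] = u * `|q.[2 + h * u ^+ 2]|.
Proof.
move=> u0; rewrite rmorphM/= map_polyX hornerM hornerX map_comp_poly horner_comp.
have -> : (map_poly rc (2%:P - h *: 'X^2)).[Complex 0 u] = rc (2 + h * u ^+ 2).
  rewrite rmorphB/= map_polyC map_polyZ/= map_polyXn !(hornerD, hornerN, hornerC, hornerZ, hornerXn) expr2.
  by simpc; rewrite ?mulr1 ?opprK.
by rewrite horner_map Normc.normcM /= !expr0n/= add0r addr0 !sqrtr_sqr ger0_norm.
Qed.

Lemma evenizedN1 q h : (evenized q h).[-1] = - q.[2 - h].
Proof. by rewrite /evenized !hornerE horner_comp !(hornerD, hornerN, hornerC, hornerZ, hornerXn) sqrrN expr1n mulr1 mulN1r. Qed.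

Lemma continuous_rprodV l : continuous (fun u => (rprod l u)^-1).
Proof.
move=> u; apply: cvgV; first by rewrite gt_eqF// rprod_gt0.
rewrite /rprod; elim: l => [|a l IH].
  by under eq_fun do rewrite big_nil; rewrite big_nil; exact: cvg_cst.
under eq_fun do rewrite big_cons; rewrite big_cons; apply: cvgM IH.
apply: continuous_comp; last exact: sqrt_continuous.
apply: (@continuous_comp _ _ _ (fun u : R => a * u) (fun x => 1 + x ^+ 2)).
  exact: mulrl_continuous.
exact: continuous_oneDsqr.
Qed.

(** Where u and q(2 + h u^2) are nonnegative, this is the modulus of [evenized q h] at i u, divided
    by 1 + u^2. *)
Definition evenized_kernel (q : {poly R}) (h u : R) := u * q.[2 + h * u ^+ 2] / (1 + u ^+ 2).

Lemma measurable_evenized_kernel q h (D : set R) : measurable_fun D (evenized_kernel q h).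
Proof.
apply: measurable_funTS; apply: measurable_funM; last first.
  by apply: continuous_measurable_fun; exact: continuous_oneDsqrV.
rewrite (_ : (fun _ => _) = horner ('X * (q \Po (2%:P + h *: 'X^2)))).
  exact: measurable_poly.
by apply/funext => u; rewrite hornerM hornerX horner_comp !(hornerD, hornerN, hornerC, hornerZ, hornerXn).
Qed.

(** The Poisson formula for [evenized q h] over [cprod l], whose value at -1 is - q(2 - h) / prod (1
    + a); on the imaginary axis the real part is bounded by the modulus. *)
Lemma le_integral_kernel_rprod l (q : {poly R}) (h : R) :
  uniq l -> all (fun a => (0 < a) && (a != 1)) l ->
  (size (evenized q h) <= size l)%N ->
  (forall u : R, 0 <= q.[2 + h * u ^+ 2]) ->
  ((pi / 2 * q.[2 - h] / \prod_(a <- l) (1 + a))%:E <=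
   \int[mu]_(u in H) (evenized_kernel q h u / rprod l u)%:E)%E.
Proof.
move=> ul l0 sq q0.
have l0' : all (fun a => 0 < a) l by apply: sub_all l0 => x /andP[].
have := poisson_ratio ul l0 sq; rewrite /poisson.
have -> : Re ((map_poly rc (evenized q h)).[-1] / cprod l (-1)) =
    - (q.[2 - h] / \prod_(a <- l) (1 + a)).
  have -> : cprod l (-1) = rc (\prod_(a <- l) (1 + a)).
    rewrite rmorph_prod /cprod; apply: eq_bigr => a _.
    by rewrite mulrN1 opprK rmorphD rmorph1.
  have -> : -1 = rc (-1) by rewrite rmorphN rmorph1.
  by rewrite horner_map -fmorphV -rmorphM evenizedN1 /= mulNr.
set f := fun u : R => _; move=> [fi fE].
have P0 : 0 < \prod_(a <- l) (1 + a).
  rewrite big_seq prodr_gt0// => a al; rewrite addr_gt0//.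
  exact: (allP l0').
apply: (@le_trans _ _ `|\int[mu]_(u in H) (f u)%:E|%E).
  by rewrite fE mulrN /= lee_fin normrN mulrA ler_norm.
apply: le_trans (le_abse_integral _ _ _) _ => //; first exact: measurable_int fi.
have u1 (u : R) : 0 < 1 + u ^+ 2 by rewrite ltr_pwDl ?sqr_ge0.
apply: ge0_le_integral => //.
- by apply: measurableT_comp => //; exact: measurable_int fi.
- apply/measurable_EFinP; apply: measurable_funM.
    exact: measurable_evenized_kernel.
  by apply: measurable_funTS; apply: continuous_measurable_fun; exact: continuous_rprodV.
move=> u /=; rewrite in_itv/= andbT => u0; rewrite lee_fin /f.
rewrite normrM [X in _ * X]ger0_norm ?invr_ge0 ?(ltW (u1 _))//.
rewrite /evenized_kernel mulrAC ler_pM2r ?invr_gt0//.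
rewrite (le_trans (Re_le_normc _))// Normc.normcM Normc.normcV normc_cprod normc_evenized//.
by rewrite ger0_norm.
Qed.

(** The number of poles tends to infinity while the denominator at -1 stays below P. This makes the
    constant independent of the degree of q. *)
Lemma le_integral_kernel_limit (a_ : nat -> R) (P : R) (q : {poly R}) (h : R) (K : R -> R) :
  injective a_ -> (forall n, 0 < a_ n) -> (forall n, a_ n != 1) ->
  (forall n, \prod_(a <- mkseq a_ n) (1 + a) <= P) ->
  (forall u : R, 0 <= q.[2 + h * u ^+ 2]) -> 0 <= q.[2 - h] ->
  measurable_fun H K -> (forall u, 0 <= K u) ->
  (forall u, 0 <= u -> exists N, forall n, (N <= n)%N -> 1 <= K u * rprod (mkseq a_ n) u) ->
  ((pi / 2 * q.[2 - h] / P)%:E <=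
   \int[mu]_(u in H) (evenized_kernel q h u * K u)%:E)%E.
Proof.
move=> inj a0 a1 aP q0 q0' mK K0 hK.
pose W := evenized_kernel q h; pose n0 := size (evenized q h).
have W0 u : 0 <= u -> 0 <= W u.
  by move=> u0; rewrite /W /evenized_kernel divr_ge0 ?mulr_ge0 ?addr_ge0 ?sqr_ge0.
(* The offset [n0] guarantees more poles than the degree of the numerator. *)
pose f n u := W u / rprod (mkseq a_ (n0 + n)) u.
(* [K] bounds 1 / [rprod] eventually but need not be its limit, so dominated convergence is applied
   to the excess, which at each u vanishes for large n. *)
pose r n u := Num.max (f n u - W u * K u) 0.
have mW : measurable_fun H W by exact: measurable_evenized_kernel.
have mf n : measurable_fun H (f n).
  apply: measurable_funM => //.
  by apply: measurable_funTS; apply: continuous_measurable_fun; exact: continuous_rprodV.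
have mWK : measurable_fun H (fun u => W u * K u) by exact: measurable_funM.
have mr n : measurable_fun H (r n).
  apply: measurable_maxr; last exact: measurable_cst.
  exact: measurable_funB.
have all0 n : all (fun a : R => (0 < a) && (a != 1)) (mkseq a_ n).
  by apply/allP => x /mapP[i _ ->]; rewrite a0 a1.
have pos n : all (fun a : R => 0 < a) (mkseq a_ n).
  by apply: sub_all (all0 n) => x /andP[].
have lef n : ((pi / 2 * q.[2 - h] / P)%:E <= \int[mu]_(u in H) (f n u)%:E)%E.
  apply: le_trans (le_integral_kernel_rprod _ (all0 (n0 + n)%N) _ q0).
  - have P0 : 0 < \prod_(a <- mkseq a_ (n0 + n)) (1 + a).
      rewrite big_seq prodr_gt0// => a /(allP (pos (n0 + n)%N)) a00.
      by rewrite addr_gt0.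
    rewrite lee_fin ler_wpM2l//; first by rewrite !mulr_ge0 ?pi_ge0.
    by rewrite lef_pV2 ?posrE ?(lt_le_trans P0).
  - by rewrite map_inj_uniq ?iota_uniq.
  - by rewrite size_mkseq leq_addr.
(* The first [n0] factors already control the numerator and all further ones are at least 1, so one
   D serves every n. *)
have [|D D0 hD] := @bounded_ratio _ (evenized q h) (pos n0); first by rewrite size_mkseq.
have f0 n u : 0 <= u -> 0 <= f n u.
  by move=> u0; rewrite divr_ge0 ?W0// ltW// rprod_gt0.
have leD n u : 0 <= u -> f n u <= D * (1 / (1 + (1 * u) ^+ 2)).
  move=> u0; rewrite /f /W /evenized_kernel mul1r mul1r mulrAC.
  rewrite ler_pM2r ?invr_gt0 ?ltr_pwDl ?sqr_ge0//.
  rewrite ler_pdivrMr ?rprod_gt0//.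
  have := hD u; rewrite normc_evenized// ger0_norm// => /le_trans; apply.
  rewrite ler_wpM2l// /mkseq iotaD map_cat /rprod big_cat/=.
  by rewrite ler_peMr ?(ltW (rprod_gt0 _ _))//; exact: rprod_ge1.
have r0 n u : 0 <= r n u by rewrite /r le_max lexx orbT.
have rD n u : 0 <= u -> r n u <= D * (1 / (1 + (1 * u) ^+ 2)).
  move=> u0; rewrite /r ge_max; apply/andP; split.
    by rewrite (le_trans _ (leD n u u0))// gerBl mulr_ge0 ?W0.
  exact: le_trans (f0 n u u0) (leD n u u0).
have [Dint _] := has_integralZ D (@has_integral_lorentz R 1 ltr01).
have [| | |//| |_ _ rlim] := @dominated_convergence _ _ _ mu H (measurable_itv _)
  (fun n => EFin \o r n) (cst 0%E) (fun u => (D * (1 / (1 + (1 * u) ^+ 2)))%:E).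
- move=> n; apply/measurable_EFinP; exact: mr.
- exact: measurable_cst.
- apply/aeW => u /=; rewrite in_itv/= andbT => u0.
  have [N hN] := hK u u0; apply: cvg_near_cst; near=> n.
  rewrite /r; congr EFin; apply/max_idPr.
  rewrite subr_le0 /f ler_pdivrMr ?rprod_gt0// -mulrA ler_peMr ?W0//.
  apply: hN; rewrite (leq_trans _ (leq_addl _ _))//.
  by near: n; exists N.
- apply/aeW => u n /=; rewrite in_itv/= andbT => u0.
  by rewrite lee_fin ger0_norm ?rD.
rewrite integral_cst//= mul0e in rlim.
apply/lee_addgt0Pr => e e0.
have : \forall n \near \oo, (\int[mu]_(x in H) (r n x)%:E <= e%:E)%E.
  move/fine_cvgP : rlim => [fin_r /cvgrPdist_le /(_ e e0) rlim].
  near=> n; have fr : (\int[mu]_(x in H) (r n x)%:E)%E \is a fin_num by near: n; exact: fin_r.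
  rewrite -(fineK fr) lee_fin (le_trans (ler_norm _))//.
  by rewrite -normrN -[X in `|X|]add0r; near: n; exact: rlim.
move=> [N _ /(_ N (leqnn _))] rN.
apply: (le_trans (lef N)); apply: (@le_trans _ _
   (\int[mu]_(u in H) ((W u * K u)%:E + (r N u)%:E))%E).
  apply: ge0_le_integral => //.
  - by move=> u /=; rewrite in_itv/= andbT => u0; rewrite lee_fin f0.
  - by apply/measurable_EFinP; exact: mf.
  - by apply: emeasurable_funD; apply/measurable_EFinP; [exact: mWK|exact: mr].
  - move=> u _; rewrite -EFinD lee_fin -lerBlDl /r le_max lexx//.
rewrite ge0_integralD//.
- by rewrite leeD2l.
- by move=> u /=; rewrite in_itv/= andbT => u0; rewrite lee_fin mulr_ge0 ?W0.
- by apply/measurable_EFinP; exact: mWK.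
- by move=> u _; rewrite lee_fin.
- by apply/measurable_EFinP; exact: mr.
Unshelve. all: by end_near. Qed.
End evaluation_bound.

(** * The choice of the poles *)

Section kernel_choice.
Context {R : realType}.
Local Notation mu := (@lebesgue_measure R).
Local Notation H := (`[0%R, +oo[%classic : set R).

(** With y = x + 1, x^(-e) = y^(-e) exp(- e ln(x/y)); then ln(x/y) <= -1/y and exp z >= 1 + z. *)
Lemma powRN_telescope (e x : R) : 0 < e -> 0 < x ->
  e * (x + 1) `^ (- (1 + e)) <= x `^ (- e) - (x + 1) `^ (- e).
Proof.
move=> e0 x0; set y := x + 1; have y0 : 0 < y by rewrite addr_gt0.
have hy : 1 + - y^-1 = x / y by rewrite /y; field; rewrite gt_eqF.
have lny : ln (x / y) <= - y^-1.
  by rewrite -hy le_ln1Dx// ltrN2 invf_lt1// ltrDr.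
have -> : x `^ (- e) = y `^ (- e) * expR (- e * ln (x / y)).
  rewrite /powR !gt_eqF// -expRD; congr expR.
  by rewrite ln_div ?posrE// mulrBr addrC subrK.
have -> : y `^ (- (1 + e)) = y `^ (- e) / y.
  have yn0 : y != 0 by rewrite gt_eqF.
  by rewrite opprD addrC powRD ?yn0 ?implybT// powR_inv1// ltW.
rewrite mulrCA -[X in _ - X]mulr1 -mulrBr ler_wpM2l ?powR_ge0//.
rewrite lerBrDl (le_trans _ (expR_ge1Dx _))// lerD2l mulNr -mulrN ler_wpM2l ?(ltW e0)//.
by rewrite lerNr.
Qed.

Lemma sum_powRN_le (s : R) : 1 < s ->
  exists M, forall n, \sum_(k <- iota 0 n) k.+1%:R `^ (- s) <= M.
Proof.
move=> s1; pose e := s - 1; have e0 : 0 < e by rewrite subr_gt0.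
exists (1 + e^-1) => -[|n]; first by rewrite big_nil addr_ge0 ?invr_ge0 ?ltW.
(* The bound is strengthened by the telescoping term so that the induction closes. *)
rewrite (@le_trans _ _ (1 + e^-1 * (1 - n.+1%:R `^ (- e))))//; last first.
  by rewrite lerD2l ler_piMr ?invr_ge0 ?(ltW e0)// gerBl powR_ge0.
elim: n => [|n IH]; first by rewrite big_seq1 !powR1 subrr mulr0 addr0.
rewrite -[n.+2]addn1 iotaD big_cat big_seq1 add0n.
rewrite (le_trans (lerD IH (lexx _)))// -addrA lerD2l.
rewrite -lerBrDl -mulrBr addn1.
have -> (a b : R) : 1 - a - (1 - b) = b - a by ring.
rewrite -ler_pdivrMl ?invr_gt0// invrK.
have := @powRN_telescope e n.+1%:R e0 (ltr0Sn _ _).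
by rewrite natr1 (_ : 1 + e = s)// /e addrC subrK.
Qed.

Lemma prod1D_le_expR (s : seq R) : all (fun a => 0 <= a) s ->
  \prod_(a <- s) (1 + a) <= expR (\sum_(a <- s) a).
Proof.
elim: s => [|a s IH /= /andP[a0 s0]]; first by rewrite !big_nil expR0.
rewrite !big_cons expRD ler_pM ?expR_ge1Dx ?IH ?addr_ge0//.
by rewrite big_seq prodr_ge0// => b /(allP s0) b0; rewrite addr_ge0.
Qed.

(* 21/2 is not an integer, so that no [pole s k] equals 1. *)
Definition pole (s : R) (k : nat) : R := (21 / 2 / k.+1%:R) `^ s.

Lemma pole_base_gt0 k : 0 < 21 / 2 / k.+1%:R :> R.
Proof. by rewrite !divr_gt0. Qed.

Lemma pole_gt0 s k : 0 < pole s k.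
Proof. by rewrite powR_gt0// pole_base_gt0. Qed.

Lemma pole_neq1 s k : s != 0 -> pole s k != 1.
Proof.
move=> s0; apply/eqP => /(congr1 (@ln R)); rewrite ln_powR ln1 => /eqP.
rewrite mulf_eq0 (negPf s0)/= ln_eq0 ?pole_base_gt0// => /eqP.
move=> /(congr1 (fun x => x * (2 * k.+1%:R))); rewrite mul1r => h.
have {}h : 21 = 2 * k.+1%:R :> R by rewrite -h; field; rewrite nat1r pnatr_eq0.
by move/eqP : h; rewrite -natrM eqr_nat mul2n => /eqP/(congr1 odd); rewrite odd_double.
Qed.

Lemma pole_inj s : s != 0 -> injective (pole s).
Proof.
move=> s0 i j /(congr1 (@ln R)); rewrite !ln_powR => /(mulfI s0).
move=> /ln_inj; rewrite !posrE !pole_base_gt0 => /(_ isT isT).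
have c0 : 21 / 2 != 0 :> R by rewrite gt_eqF// divr_gt0.
by move/(mulfI c0)/invr_inj/eqP; rewrite eqr_nat => /eqP[].
Qed.

Lemma prod_pole_le (s : R) : 1 < s ->
  exists2 P, 0 < P & forall n, \prod_(a <- mkseq (pole s) n) (1 + a) <= P.
Proof.
move=> s1; have [M hM] := sum_powRN_le s1.
exists (expR ((21 / 2) `^ s * M)) => [|n]; first exact: expR_gt0.
rewrite (le_trans (prod1D_le_expR _))//.
  by apply/allP => a /mapP[i _ ->]; rewrite ltW ?pole_gt0.
rewrite ler_expR /mkseq big_map (le_trans _ (ler_wpM2l (powR_ge0 _ _) (hM n)))//.
rewrite mulr_sumr le_eqVlt; apply/orP; left; apply/eqP; apply: eq_bigr => i _.
by rewrite /pole powRM ?invr_ge0 ?divr_ge0// -(powR_inv1 (ler0n R i.+1)) -powRrM mulN1r.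
Qed.

(** About 4 u^b of the factors are at least 2, and the others at least 1. *)
Lemma rprod_pole_ge (b u : R) : 0 < b < 1 -> 1 <= u ->
  exists N, forall n, (N <= n)%N ->
    expR (2 * u `^ b) <= rprod (mkseq (pole b^-1) n) u.
Proof.
move=> /andP[b0 b1] u1; have u0 : 0 < u by rewrite (lt_le_trans _ u1).
have ub1 : 1 <= u `^ b by rewrite -(powRr0 u) ler_powR// ltW.
(* Thus 4 u^b <= K <= 5 u^b. For k < K, the k-th pole times u is at least 2 because 2^b (k + 1) <=
   10 u^b <= (21/2) u^b, while 2^K >= exp(K/2) >= exp(2 u^b). *)
pose K := (Num.truncn (4 * u `^ b)).+1.
have K4 : 4 * u `^ b <= K%:R by rewrite ltW// truncnS_gt.
have K5 : K%:R <= 5 * u `^ b.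
  have : (Num.truncn (4 * u `^ b))%:R <= 4 * u `^ b.
    by rewrite truncn_le mulr_ge0 ?powR_ge0.
  by rewrite /K -natr1; lra.
exists K => n Kn.
have fac k : (k < K)%N -> 2 <= Num.sqrt (1 + (pole b^-1 k * u) ^+ 2).
  move=> kK.
  have h2 : 2 <= pole b^-1 k * u.
    rewrite -ler_pdivrMr//.
    have -> : 2 / u = (2 `^ b / u `^ b) `^ b^-1.
      rewrite powRM ?powR_ge0 ?invr_ge0 ?powR_ge0// -powRrM mulfV ?gt_eqF// powRr1//.
      by rewrite -powRN -powRrM mulNr mulfV ?gt_eqF// powR_inv1// ltW.
    rewrite ge0_ler_powR ?invr_ge0 ?(ltW b0)// ?nnegrE ?divr_ge0 ?powR_ge0//.
    rewrite ler_pdivrMr ?powR_gt0// mulrAC ler_pdivlMr//.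
    rewrite (@le_trans _ _ (2 * (5 * u `^ b)))//.
      rewrite ler_pM ?powR_ge0//.
        by rewrite -[leRHS]powRr1// ler_powR ?ler1n// ltW.
      by rewrite (le_trans _ K5)// ler_nat.
    rewrite mulrA ler_wpM2r ?powR_ge0//; lra.
  rewrite -[leLHS]ger0_norm// -sqrtr_sqr ler_wsqrtr// (@le_trans _ _ ((pole b^-1 k * u) ^+ 2)) ?lerDr//.
  by rewrite ler_pXn2r ?nnegrE// (le_trans _ h2).
have : 2 ^+ K <= rprod (mkseq (pole b^-1) n) u.
  rewrite -(subnKC Kn) /mkseq iotaD map_cat /rprod big_cat/=.
  have h2 : 2 ^+ K <= \prod_(a <- map (pole b^-1) (iota 0 K)) Num.sqrt (1 + (a * u) ^+ 2).
    rewrite -[in leLHS](subn0 K) -prodr_const_nat big_map.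
    rewrite (_ : iota 0 K = index_iota 0 K) ?/index_iota ?subn0//.
    rewrite big_seq [leRHS]big_seq.
    by apply: ler_prod => k; rewrite mem_iota/= add0n => kK; rewrite ler0n fac.
  rewrite (le_trans h2)// ler_peMr ?(le_trans _ h2) ?exprn_ge0//.
  exact: rprod_ge1.
apply: le_trans.
rewrite (@le_trans _ _ (expR (2^-1 * K%:R)))//.
  rewrite ler_expR; lra.
rewrite expRM_natr.
rewrite ler_pXn2r ?nnegrE ?expR_ge0//.
(* exp(1/2) <= 2 follows from exp(-1/2) >= 1 - 1/2. *)
rewrite -[leRHS]invrK -[leLHS]invrK lef_pV2 ?posrE ?invr_gt0 ?expR_gt0//.
by rewrite -expRN (le_trans _ (expR_ge1Dx _))//; lra.
Qed.

(** The limit bound with poles of exponent 1/b and K(u) = e^2 exp(-(2 + h u^2)^(b/2)). *)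
Lemma evaluation_le_integral (b : R) : 0 < b < 1 ->
  exists2 c, 0 < c & forall (q : {poly R}) h, 0 <= h <= 2 ->
    (forall t, 0 <= t -> 0 <= q.[t]) ->
    ((q.[2 - h])%:E <= c%:E * \int[mu]_(u in H)
       (evenized_kernel q h u * expR (- ((2 + h * u ^+ 2) `^ (b / 2))))%:E)%E.
Proof.
move=> b01; have /andP[b0 b1] := b01.
have bV1 : 1 < b^-1 by rewrite invf_gt1.
have [P P0 hP] := prod_pole_le bV1.
have c0 : 0 < pi / 2 / P by rewrite !divr_gt0// pi_gt0.
exists ((pi / 2 / P)^-1 * expR 2) => [|q h /andP[h0 h2] q0].
  by rewrite mulr_gt0 ?expR_gt0 ?invr_gt0.
have t0 (u : R) : 0 <= 2 + h * u ^+ 2.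
  by apply: addr_ge0 => //; apply: mulr_ge0 => //; exact: sqr_ge0.
pose E u := expR (- ((2 + h * u ^+ 2) `^ (b / 2))).
have mE (D : set R) : measurable_fun D E.
  apply: measurable_funTS; apply: measurableT_comp => //; apply: measurableT_comp => //.
  apply: (measurableT_comp (measurable_powR (b / 2))).
  apply: measurable_funD => //; apply: measurable_funM => //.
have bn0 : b^-1 != 0 by rewrite gt_eqF ?invr_gt0.
have q2h : 0 <= q.[2 - h] by rewrite q0// subr_ge0.
have mK : measurable_fun H (fun u => expR 2 * E u) by exact: measurable_funM.
have K0 u : 0 <= expR 2 * E u by rewrite mulr_ge0 ?expR_ge0.
have := @le_integral_kernel_limit R (pole b^-1) P q h _ (pole_inj bn0)
  (pole_gt0 _) (fun k => pole_neq1 k bn0) hP (fun u => q0 _ (t0 u)) q2h mK K0.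
have -> : (\int[mu]_(u in H) (evenized_kernel q h u * (expR 2 * E u))%:E =
  (expR 2)%:E * \int[mu]_(u in H) (evenized_kernel q h u * E u)%:E)%E.
  rewrite -ge0_integralZl//.
  - by apply: eq_integral => u _; rewrite -EFinM mulrCA.
  - apply/measurable_EFinP; apply: measurable_funM => //.
      exact: measurable_evenized_kernel.
    exact: mE.
  - move=> u /=; rewrite in_itv/= andbT => u0.
    rewrite lee_fin mulr_ge0 ?expR_ge0// /evenized_kernel.
    by rewrite !mulr_ge0 ?invr_ge0 ?addr_ge0 ?sqr_ge0 ?q0 ?t0.
move=> main.
have {main} /(_ _) main := main _.
rewrite EFinM -muleA.
apply: (@le_trans _ _ (((pi / 2 / P)^-1)%:E * (pi / 2 * q.[2 - h] / P)%:E)%E).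
  have -> : pi / 2 * q.[2 - h] / P = pi / 2 / P * q.[2 - h] by rewrite mulrAC.
  rewrite -EFinM lee_fin.
  by rewrite mulKf// gt_eqF.
apply: lee_wpmul2l; first by rewrite lee_fin invr_ge0 ltW.
apply: main => u u0.
have hb : 0 <= b / 2 by rewrite divr_ge0// ltW.
have four : 4 `^ (b / 2) <= 2 :> R.
  have -> : 4 = 2 `^ 2 :> R by rewrite powR_mulrn// -natrX.
  by rewrite -powRrM mulrC divfK// -[leRHS]powRr1// ler_powR ?ler1n// ltW.
have tle (x : R) : 2 + h * u ^+ 2 <= x -> (2 + h * u ^+ 2) `^ (b / 2) <= x `^ (b / 2).
  by move=> tx; rewrite ge0_ler_powR ?nnegrE// (le_trans _ tx).
have hu : h * u ^+ 2 <= 2 * u ^+ 2 by rewrite ler_wpM2r ?sqr_ge0.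
(* For u >= 1, 2 + h u^2 <= 4 u^2 and 4^(b/2) <= 2 bound the exponent by 2 u^b, which [rprod]
   compensates. For u < 1 the exponent is at most 4^(b/2) <= 2, which the factor e^2 absorbs. *)
have [u1|u1] := leP 1 u.
  have [N hN] := rprod_pole_ge b01 u1.
  exists N => n /hN le_rprod.
  have tu : (2 + h * u ^+ 2) `^ (b / 2) <= 2 * u `^ b.
    rewrite (le_trans (tle (4 * u ^+ 2) _))//.
      have : 1 <= u ^+ 2 by rewrite exprn_ege1.
      by move: hu; lra.
    rewrite powRM ?sqr_ge0// -(@powR_mulrn _ u)// -powRrM [2%:R * _]mulrC divfK//.
    by rewrite ler_wpM2r ?powR_ge0.
  rewrite (@le_trans _ _ (1 * expR (- (2 * u `^ b)) * expR (2 * u `^ b)))//.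
    by rewrite mul1r -expRD addNr expR0.
  rewrite ler_pM ?mulr_ge0 ?expR_ge0// ler_pM ?expR_ge0 ?expR_ge1//.
    by rewrite -[leLHS]expR0 ler_expR.
  by rewrite ler_expR lerN2.
exists 0%N => n _; rewrite -[leLHS]mulr1 ler_pM ?rprod_ge1//.
rewrite -expRD -[leLHS]expR0 ler_expR subr_ge0 (le_trans (tle 4 _))//.
have : u ^+ 2 <= 1 by rewrite exprn_ile1// ltW.
by move: hu; lra.
Qed.

End kernel_choice.

(** * Change of variables *)

Section substitution.
Context {R : realType}.
Local Notation mu := (@lebesgue_measure R).
Local Notation H := (`[0%R, +oo[%classic : set R).

Lemma horner_continuous (p : {poly R}) : continuous (horner p).
Proof.
by move=> x; apply/differentiable_continuous/derivable1_diffP; exact: derivable_horner.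
Qed.

Lemma integration_by_substitution_poly (F : {poly R}) (G : R -> R) a b : a <= b ->
  {in `[a, b] &, {homo horner F : x y / x < y}} ->
  {within `[F.[a], F.[b]], continuous G} ->
  (\int[mu]_(t in `[F.[a], F.[b]]) (G t)%:E =
   \int[mu]_(x in `[a, b]) (G F.[x] * F^`().[x])%:E)%E.
Proof.
move=> ab incF cG.
rewrite (@integration_by_substitution_increasing _ (horner F) G a b)//.
- by apply: eq_integral => x _; rewrite -derivE.
- by rewrite -derivE => x _; exact: horner_continuous.
- rewrite -derivE; apply/cvg_ex; exists (F^`()).[a].
  by apply: cvg_at_right_filter; exact: horner_continuous.
- rewrite -derivE; apply/cvg_ex; exists (F^`()).[b].
  by apply: cvg_at_left_filter; exact: horner_continuous.
- split; first by move=> x _; exact: derivable_horner.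
    by apply: cvg_at_right_filter; exact: horner_continuous.
  by apply: cvg_at_left_filter; exact: horner_continuous.
Qed.

Lemma continuous_kernel (q : {poly R}) (g t0 t : R) : t0 < t -> 0 < t ->
  {for t, continuous (fun t => q.[t] * expR (- (t `^ g)) / (t - t0))}.
Proof.
move=> t0t t_gt0; apply: cvgM.
  apply: cvgM; first exact: horner_continuous.
  apply: continuous_comp; last exact: continuous_expR.
  apply: cvgN; have : {for t, continuous (powR (R:=R) ^~ g)}.
    apply/differentiable_continuous/derivable1_diffP.
    by apply: derivable_powR; rewrite in_itv/= t_gt0.
  exact.
apply: cvgV; first by rewrite gt_eqF// subr_gt0.
by apply: cvgB; [exact: cvg_id|exact: cvg_cst].
Qed.

Lemma measurable_substituted (F : {poly R}) (G : R -> R) (D : set R) : measurable D ->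
  (forall x, D x -> {for F.[x], continuous G}) ->
  measurable_fun D (fun x => G F.[x] * F^`().[x]).
Proof.
move=> mD cG; apply: measurable_funM; last exact: measurable_poly.
apply: subspace_continuous_measurable_fun => //.
apply: continuous_in_subspaceT => x; rewrite inE => Dx.
by apply: continuous_comp; [exact: horner_continuous|exact: cG].
Qed.

Definition fpoly (m : nat) : {poly R} := 'X^2 + 'X^(2 * m + 2).

Lemma horner_fpoly m x : (fpoly m).[x] = x ^+ 2 + x ^+ (2 * m + 2).
Proof. by rewrite hornerD !hornerXn. Qed.

Lemma fpoly_ge m (x : R) : 1 <= x -> x <= (fpoly m).[x].
Proof.
move=> x1; rewrite horner_fpoly (@le_trans _ _ (x ^+ 2))//.
  by rewrite -[leLHS]expr1 ler_weXn2l.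
by rewrite lerDl exprn_ge0// (le_trans _ x1).
Qed.

Lemma fpoly_lt m (x y : R) : 0 <= x -> x < y -> (fpoly m).[x] < (fpoly m).[y].
Proof.
move=> x0 xy; have y0 : 0 <= y by rewrite (le_trans x0)// ltW.
by rewrite !horner_fpoly ltrD// ltr_pXn2r ?addn2// nnegrE.
Qed.

(** Both t = 2 + h u^2 for u >= 0 and t = [fpoly m] at x >= 1 parametrize t >= 2. With t0 = 2 - h, u
    du/(1 + u^2) = dt/(2 (t - t0)), and the factor 1/2 is dropped. *)
Lemma le_integral_substitution (q : {poly R}) (g h : R) m : 1 <= h <= 2 ->
  (forall t, 0 <= t -> 0 <= q.[t]) ->
  (\int[mu]_(u in H) (evenized_kernel q h u * expR (- ((2 + h * u ^+ 2) `^ g)))%:E <=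
   \int[mu]_(x in `[1%R, +oo[)
     (q.[(fpoly m).[x]] * expR (- ((fpoly m).[x] `^ g)) / ((fpoly m).[x] - (2 - h)) *
      (fpoly m)^`().[x])%:E)%E.
Proof.
move=> /andP[h1 h2] q0; set A := (X in (_ <= X)%E).
have h0 : 0 < h by rewrite (lt_le_trans _ h1).
pose G t := q.[t] * expR (- (t `^ g)) / (t - (2 - h)).
pose F := 2%:P + h *: 'X^2 : {poly R}.
have FE u : F.[u] = 2 + h * u ^+ 2 by rewrite hornerD hornerC hornerZ hornerXn.
have F2 u : 2 <= F.[u] by rewrite FE lerDl mulr_ge0 ?(ltW h0) ?sqr_ge0.
have G0 t : 2 <= t -> 0 <= G t.
  move=> t2; rewrite divr_ge0 ?mulr_ge0 ?expR_ge0 ?q0 ?(le_trans _ t2)//.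
  by lra.
have cG t : 2 <= t -> {for t, continuous G}.
  by move=> t2; apply: continuous_kernel; lra.
have cGw b : {within `[2, b], continuous G}.
  by apply: continuous_in_subspaceT => t; rewrite inE/= in_itv/= => /andP[t2 _]; exact: cG.
(* The absolute value changes nothing on u >= 0, but makes the integrand nonnegative on the whole
   line, as the exhaustion by compact intervals requires. *)
pose k u := `|evenized_kernel q h u * expR (- ((2 + h * u ^+ 2) `^ g))|.
have kE (u : R) : 0 <= u -> k u = G F.[u] * F^`().[u] / 2.
  move=> u0; rewrite /k /evenized_kernel -FE ger0_norm; last first.
    by rewrite !mulr_ge0 ?expR_ge0 ?q0 ?invr_ge0 ?addr_ge0 ?sqr_ge0 ?(le_trans _ (F2 u)).
  rewrite /G; have -> : F.[u] - (2 - h) = h * (1 + u ^+ 2) by rewrite FE; ring.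
  have -> : F^`().[u] = h * u * 2.
    rewrite /F derivD derivC derivZ derivXn add0r hornerZ hornerMn hornerXn expr1.
    by rewrite -mulrA mulr_natr.
  field; rewrite (gt_eqF h0)/= gt_eqF//.
  by rewrite ltr_pwDl ?sqr_ge0.
have -> : (\int[mu]_(u in H) (evenized_kernel q h u * expR (- ((2 + h * u ^+ 2) `^ g)))%:E =
   \int[mu]_(u in H) (k u)%:E)%E.
  apply: eq_integral => u; rewrite inE/= in_itv/= andbT => u0; rewrite /k ger0_norm//.
  by rewrite !mulr_ge0 ?expR_ge0 ?q0 -?FE ?invr_ge0 ?addr_ge0 ?sqr_ge0 ?(le_trans _ (F2 u)).
have mk : measurable_fun setT k.
  apply: measurableT_comp => //; apply: measurable_funM.
    exact: measurable_evenized_kernel.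
  apply: measurableT_comp => //; apply: measurableT_comp => //.
  apply: (measurableT_comp (measurable_powR g)).
  by apply: measurable_funD => //; apply: measurable_funM.
rewrite ge0_integral_ereal_sup//; last by move=> u; rewrite normr_ge0.
apply: ge_ereal_sup => _ [n _ <-].
have F20 : F.[0] = 2 by rewrite FE expr0n mulr0 addr0.
have f21 : (fpoly m).[1] = 2 by rewrite horner_fpoly !expr1n.
pose N : R := n.+1%:R.
have homF : {in `[0, N] &, {homo horner F : x y / x < y}}.
  move=> x y; rewrite !in_itv/= => /andP[x0 _] /andP[y0 _] xy.
  by rewrite !FE ltrD2l ltr_pM2l// ltr_pXn2r.
have cGF : {within `[F.[0], F.[N]], continuous G} by rewrite F20; exact: cGw.
have N0 : 0 <= N by rewrite ler0n.
have FN1 : 1 <= F.[N] by rewrite (le_trans _ (F2 N))// ler1n.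
have homf : {in `[1, F.[N]] &, {homo horner (fpoly m) : x y / x < y}}.
  move=> x y; rewrite !in_itv/= => /andP[x0 _] _; apply: fpoly_lt.
  exact: le_trans ler01 x0.
have subF := integration_by_substitution_poly N0 homF cGF.
have cGf : {within `[(fpoly m).[1], (fpoly m).[F.[N]]], continuous G}.
  by rewrite f21; exact: cGw.
have subf := integration_by_substitution_poly FN1 homf cGf.
have fge2 x : 1 <= x -> 2 <= (fpoly m).[x].
  move=> x1; rewrite -f21; have [->//|x1'] := eqVneq x 1.
  by rewrite ltW// fpoly_lt// lt_neqAle eq_sym x1'.
have df0 x : 0 <= x -> 0 <= (fpoly m)^`().[x].
  move=> x0; rewrite derivD !derivXn hornerD !hornerMn !hornerXn.
  by rewrite addr_ge0// mulrn_wge0// exprn_ge0.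
have mG (b : R) : measurable_fun (`[2%R, b]%classic : set R) G.
  by apply: subspace_continuous_measurable_fun => //; exact: cGw.
have mA : measurable_fun (`[1%R, +oo[%classic : set R) (fun x => G (fpoly m).[x] * (fpoly m)^`().[x]).
  apply: measurable_substituted => // x /=; rewrite in_itv/= andbT => x1.
  by apply: cG; exact: fge2.
apply: (@le_trans _ _ (\int[mu]_(u in `[0%R, N]) (G F.[u] * F^`().[u])%:E)%E).
  apply: ge0_le_integral => //.
  - by move=> u _; rewrite lee_fin normr_ge0.
  - apply/measurable_EFinP; apply: measurable_funTS; exact: mk.
  - apply/measurable_EFinP; apply: measurable_substituted => // x _.
    exact: cG.
  - move=> u /=; rewrite in_itv/= => /andP[u0 _]; rewrite lee_fin.
    have : 0 <= k u by rewrite normr_ge0.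
    by rewrite kE//; lra.
rewrite -subF F20.
(* The right end is enlarged to a value of [fpoly m], so that the second substitution has an
   explicit end point in x. *)
apply: (@le_trans _ _ (\int[mu]_(t in `[2%R, (fpoly m).[F.[N]]]) (G t)%:E)%E).
  apply: ge0_subset_integral => //.
  - by apply/measurable_EFinP; exact: mG.
  - by move=> t /=; rewrite in_itv/= => /andP[t2 _]; rewrite lee_fin G0.
  - by apply: subset_itvl; rewrite bnd_simp fpoly_ge.
rewrite -f21 subf; apply: ge0_subset_integral => //.
- by apply/measurable_EFinP; exact: mA.
- move=> x /=; rewrite in_itv/= andbT => x1.
  by rewrite lee_fin mulr_ge0 ?df0 ?G0 ?fge2// (le_trans ler01).
- exact: subset_itvl.
Qed.
End substitution.

(** * The evaluation bound for the exponential power weight *)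

Section weight_bound.
Context {R : realType}.
Local Notation mu := (@lebesgue_measure R).

Definition weight (alpha x : R) : R := expR (- (`|x| `^ alpha)).

Lemma measurable_weight alpha (D : set R) : measurable_fun D (weight alpha).
Proof.
apply: measurable_funTS; apply: measurableT_comp => //; apply: measurableT_comp => //.
by apply: (measurableT_comp (measurable_powR alpha)); exact: normr_measurable.
Qed.

Lemma deriv_fpoly_le m (x : R) : 1 <= x ->
  (fpoly m)^`().[x] <= (2 * m + 2)%:R * (fpoly m).[x].
Proof.
move=> x1; have x0 : 0 <= x by rewrite (le_trans ler01).
rewrite derivD !derivXn hornerD !hornerMn !hornerXn horner_fpoly mulrDr lerD//.
  rewrite -mulr_natl; apply: ler_pM => //; first by rewrite ler_nat leq_addl.
  exact: ler_weXn2l.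
rewrite -mulr_natl ler_wpM2l// ler_weXn2l//.
by rewrite leq_pred.
Qed.

(** x^alpha is the power alpha/(2m + 2) of x^(2m + 2), the dominant term of [fpoly m]. *)
Lemma weight_ge_fpoly m (alpha x : R) : 1 <= x -> 0 < alpha ->
  expR (- ((fpoly m).[x] `^ (alpha / m.+1%:R / 2))) <= weight alpha x.
Proof.
move=> x1 a0; have x0 : 0 <= x by rewrite (le_trans ler01).
rewrite ler_expR lerN2 ger0_norm//.
have -> : x `^ alpha = (x ^+ (2 * m + 2)) `^ (alpha / m.+1%:R / 2).
  rewrite -powR_mulrn// -powRrM; congr (_ `^ _).
  rewrite natrD natrM -[m.+1%:R]natr1; field.
  by rewrite natr1 pnatr_eq0.
rewrite ge0_ler_powR ?nnegrE ?divr_ge0 ?(ltW a0) ?exprn_ge0//.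
  by rewrite horner_fpoly addr_ge0 ?exprn_ge0.
by rewrite horner_fpoly lerDr exprn_ge0.
Qed.

Lemma evaluation_le_weight_integral (alpha : R) m : 0 < alpha < m.+1%:R ->
  exists2 C, 0 < C & forall (q : {poly R}) t0, 0 <= t0 <= 1 ->
    (forall t, 0 <= t -> 0 <= q.[t]) ->
    ((q.[t0])%:E <= C%:E * \int[mu]_x (q.[(fpoly m).[x]] * weight alpha x)%:E)%E.
Proof.
move=> /andP[a0 am]; have [|c c0 hc] := @evaluation_le_integral R (alpha / m.+1%:R).
  by rewrite divr_gt0//= ltr_pdivrMr// mul1r.
(* For x >= 1 the Jacobian satisfies f' <= (2m + 2) f, and f >= 2 >= 2 t0 gives f <= 2 (f - t0);
   hence f'/(f - t0) <= K. *)
pose K : R := 2 * (2 * m + 2)%:R.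
exists (c * K) => [|q t0 /andP[t00 t01] q0].
  by rewrite mulr_gt0// mulr_gt0// ltr0n addn2.
have h12 : 1 <= 2 - t0 <= 2 by apply/andP; split; lra.
have h02 : 0 <= 2 - t0 <= 2 by apply/andP; split; lra.
have := hc q _ h02 q0; rewrite opprB addrC subrK => /le_trans; apply.
rewrite EFinM -muleA lee_wpmul2l ?lee_fin ?(ltW c0)//.
apply: (le_trans (le_integral_substitution _ m h12 q0)).
have K0 : 0 <= K by rewrite mulr_ge0.
have f0 (x : R) : 0 <= (fpoly m).[x].
  rewrite horner_fpoly addr_ge0 ?sqr_ge0//.
  by rewrite -mulnSr exprM exprn_ge0 ?sqr_ge0.
have mqw (D : set R) : measurable_fun D (fun x => q.[(fpoly m).[x]] * weight alpha x).
  apply: measurable_funM; last exact: measurable_weight.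
  under eq_fun do rewrite -horner_comp.
  exact: measurable_poly.
have f2 (x : R) : 1 <= x -> 2 <= (fpoly m).[x].
  by move=> x1; rewrite horner_fpoly lerD// exprn_ege1.
apply: (@le_trans _ _ (\int[mu]_(x in `[1%R, +oo[)
   (K%:E * (q.[(fpoly m).[x]] * weight alpha x)%:E))%E).
  apply: ge0_le_integral => //.
  - move=> x /=; rewrite in_itv/= andbT => x1; have fx2 := f2 x x1.
    rewrite lee_fin mulr_ge0//.
      rewrite divr_ge0 ?mulr_ge0 ?expR_ge0 ?q0 ?f0//; lra.
    rewrite derivD !derivXn hornerD !hornerMn !hornerXn.
    by rewrite addr_ge0// mulrn_wge0// exprn_ge0// (le_trans ler01).
  - apply/measurable_EFinP; apply: (measurable_substituted (G :=
      fun t => q.[t] * expR (- t `^ (alpha / m.+1%:R / 2)) / (t - (2 - (2 - t0))))) => // x.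
    rewrite /= in_itv/= andbT => /f2 fx2.
    by apply: continuous_kernel; lra.
  - apply/measurable_EFinP; apply: measurable_funM => //; exact: mqw.
  - move=> x /=; rewrite in_itv/= andbT => x1; have fx2 := f2 x x1.
    have D0 : 0 < (fpoly m).[x] - (2 - (2 - t0)) by lra.
    have ratio : (fpoly m)^`().[x] / ((fpoly m).[x] - (2 - (2 - t0))) <= K.
      rewrite ler_pdivrMr// (le_trans (deriv_fpoly_le m x1))//.
      rewrite /K [2 * _]mulrC -mulrA ler_wpM2l//; lra.
    have d0 : 0 <= (fpoly m)^`().[x].
      rewrite derivD !derivXn hornerD !hornerMn !hornerXn.
      by rewrite addr_ge0// mulrn_wge0// exprn_ge0// (le_trans ler01).
    rewrite -EFinM lee_fin -mulrA mulrC [_^-1 * _]mulrC; apply: ler_pM => //.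
    + by rewrite divr_ge0// ltW.
    + by rewrite mulr_ge0 ?expR_ge0 ?q0 ?f0.
    + by rewrite ler_wpM2l ?q0 ?f0// weight_ge_fpoly.
rewrite -ge0_integralZl//; last 2 first.
- by apply/measurable_EFinP; exact: mqw.
- by move=> x _; rewrite lee_fin mulr_ge0 ?expR_ge0 ?q0.
apply: ge0_subset_integral => //.
- by apply: measurable_funeM; apply/measurable_EFinP; exact: mqw.
- by move=> x _; rewrite -EFinM lee_fin !mulr_ge0 ?expR_ge0 ?q0.
Qed.

End weight_bound.

(** * Integration against a measure given by a density *)

Section density.
Local Open Scope ereal_scope.

(** Both g and the Radon-Nikodym derivative of [nu] integrate to [nu] on every measurable set, so
    they agree almost everywhere. *)
Lemma ge0_integral_density d (T : measurableType d) (R : realType)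
    (mu : {sigma_finite_measure set T -> \bar R})
    (nu : {finite_measure set T -> \bar R}) (g : T -> R) (f : T -> \bar R) :
  measurable_fun [set: T] g -> (forall x, (0 <= g x)%R) ->
  (forall A, measurable A -> nu A = \int[mu]_(x in A) (g x)%:E) ->
  measurable_fun [set: T] f -> (forall x, 0 <= f x) ->
  \int[nu]_x f x = \int[mu]_x (f x * (g x)%:E).
Proof.
move=> mg g0 nuE mf f0.
have mgE : measurable_fun [set: T] (EFin \o g) by exact/measurable_EFinP.
have numu : nu `<< mu.
  apply/null_content_dominatesP => A mA muA0; rewrite nuE// null_set_integral//.
  exact: measurable_funTS.
have gi : mu.-integrable [set: T] (EFin \o g).
  apply/integrableP; split => //.
  under eq_integral do rewrite /= ger0_norm//.
  by rewrite -nuE// ltey_eq fin_num_measure.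
rewrite -(Radon_Nikodym_SigmaFinite.change_of_variables numu)//.
have mD := measurable_int _ (Radon_Nikodym_SigmaFinite.f_integrable numu).
apply: ae_eq_integral => //.
- exact: emeasurable_funM.
- exact: emeasurable_funM.
- apply: ae_eqe_mul2l; apply: ae_eq_sym; apply: integral_ae_eq => // E _ mE.
  by rewrite -nuE// -Radon_Nikodym_SigmaFinite.f_integral.
Qed.

End density.

(** * The marginal of the exponential power measure *)

Section Gamma_marginal.
Context {R : realType}.
Local Notation mu := (@lebesgue_measure R).
Local Open Scope ereal_scope.

Lemma Gamma_fin_num_fun (alpha : R) n : (0 < alpha)%R ->
  fin_num_fun (Gamma alpha (n := n)).
Proof.
move=> a0 A mA; rewrite ge0_fin_numE// (@le_lt_trans _ _ (Gamma alpha [set: Rn R n]))//.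
  by apply: le_measure; rewrite ?inE.
by rewrite Gamma_setT// ltry.
Qed.

Lemma ge0_integral_Gamma (alpha : R) n (f : Rn R n -> \bar R) : (0 < alpha)%R ->
  measurable_fun [set: Rn R n] f -> (forall x, 0 <= f x) ->
  \int[Gamma alpha (n := n)]_x f x =
  \int[lebesgue_Rn n]_x (f x * (Gamma_density alpha x)%:E).
Proof.
move=> a0 mf f0.
have Gfin := @Gamma_fin_num_fun alpha n a0.
pose G : {measure set (Rn R n) -> \bar R} := Gamma alpha (n := n).
pose G' := HB.pack_for (FiniteMeasure.type (Rn R n) R) (Measure.sort G)
  (Measure_isFinite.Build _ _ _ (Measure.sort G) Gfin).
apply: (@ge0_integral_density _ _ _ (lebesgue_Rn n) G') => //.
- exact: measurable_Gamma_density.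
- by move=> x; exact: Gamma_density_ge0.
Qed.

Lemma Gamma_weight_cons (alpha : R) k (z : R * Rn R k) :
  Gamma_weight alpha (Rn_cons z) = (weight alpha z.1 * Gamma_weight alpha z.2)%R.
Proof.
rewrite -expRD /Gamma_weight big_ord_recl opprD.
by congr (expR (_ - _)); apply: eq_bigr => i _; rewrite tnthS.
Qed.

Lemma measurable_thead k : measurable_fun [set: Rn R k.+1] (@thead k R).
Proof. exact: measurable_tnth. Qed.

(** The density factors over the coordinates, so Tonelli leaves the first one with the constant [C]
    times the integral [W] over the others. *)
Lemma Gamma_marginal (alpha : R) k : (0 < alpha)%R ->
  exists2 c : R, (0 < c)%R & forall phi : R -> R,
    measurable_fun [set: R] phi -> (forall t, (0 <= phi t)%R) ->
    \int[Gamma alpha (n := k.+1)]_x (phi (thead x))%:E =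
    c%:E * \int[mu]_t (phi t * weight alpha t)%:E.
Proof.
move=> a0.
pose W := \int[lebesgue_Rn k]_y (Gamma_weight alpha y)%:E.
pose C : R := Gamma_const alpha k.+1.
have C0 : (0 <= C)%R by exact: Gamma_const_ge0.
have W0 : 0 <= W.
  by apply: integral_ge0 => x _; rewrite lee_fin Gamma_weight_ge0.
have marg (phi : R -> R) : measurable_fun [set: R] phi -> (forall t, (0 <= phi t)%R) ->
    \int[Gamma alpha (n := k.+1)]_x (phi (thead x))%:E =
    (C%:E * W) * \int[mu]_t (phi t * weight alpha t)%:E.
  move=> mphi phi0.
  have mpt : measurable_fun [set: Rn R k.+1] (fun x => phi (thead x)).
    by apply: measurableT_comp => //; exact: measurable_thead.
  rewrite ge0_integral_Gamma//; last 2 first.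
  - exact/measurable_EFinP.
  - by move=> x; rewrite lee_fin.
  have mE : measurable_fun [set: Rn R k.+1]
      (fun x => (phi (thead x) * Gamma_density alpha x)%:E).
    apply/measurable_EFinP; apply: measurable_funM => //.
    exact: measurable_Gamma_density.
  have E0 x : 0 <= (phi (thead x) * Gamma_density alpha (x : Rn R k.+1))%:E.
    by rewrite lee_fin mulr_ge0 ?Gamma_density_ge0.
  transitivity (\int[mu \x lebesgue_Rn k]_z
      (phi (thead (Rn_cons z)) * Gamma_density alpha (Rn_cons z))%:E).
    have := @ge0_integral_pushforward _ _ (measurableTypeR R * Rn R k)%type _ _ _
      (@measurable_Rn_cons R k) (mu \x lebesgue_Rn k) _ _ measurableT mE
      (fun x _ => E0 x).
    by rewrite preimage_setT.
  rewrite fubini_tonelli1//; last first.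
    exact: (measurableT_comp mE (@measurable_Rn_cons R k)).
  rewrite /fubini_F.
  transitivity (\int[mu]_t ((phi t * weight alpha t)%:E * (C%:E * W))).
    apply: eq_integral => t _.
    rewrite /W -!ge0_integralZl//.
    - apply: eq_integral => y _.
      by rewrite -!EFinM /Gamma_density Gamma_weight_cons theadE /C/=; congr EFin; ring.
    - apply: measurable_funeM; apply/measurable_EFinP; exact: measurable_Gamma_weight.
    - by move=> y _; rewrite mule_ge0// lee_fin// Gamma_weight_ge0.
    - by rewrite lee_fin mulr_ge0// expR_ge0.
    - by apply/measurable_EFinP; exact: measurable_Gamma_weight.
    - by move=> y _; rewrite lee_fin Gamma_weight_ge0.
  rewrite ge0_integralZr//.
  - by rewrite muleC.
  - apply/measurable_EFinP; apply: measurable_funM => //; exact: measurable_weight.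
  - by move=> t _; rewrite lee_fin mulr_ge0// expR_ge0.
  - by rewrite mule_ge0.
(* Total mass 1, that is phi = 1, forces the constant to be finite and nonzero. *)
have := marg (cst 1%R) (measurable_cst _) (fun _ => ler01).
set J := \int[mu]_t _.
have -> : \int[Gamma alpha (n := k.+1)]_x (cst 1%R (thead x))%:E = 1.
  transitivity (\int[Gamma alpha (n := k.+1)]_x (cst 1 x)).
    by apply: eq_integral.
  by rewrite integral_cst// mul1e; exact: Gamma_setT.
have J0 : 0 <= J.
  by apply: integral_ge0 => t _; rewrite lee_fin mulr_ge0// expR_ge0.
have CW0 : 0 <= C%:E * W by rewrite mule_ge0.
move: marg CW0; case: (C%:E * W) => [r| |] marg CW0 total //.
  exists r => //; rewrite lt_neqAle -lee_fin CW0 andbT eq_sym.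
  apply/eqP => r0; move: total; rewrite r0 mul0e => /eqP.
  by rewrite onee_eq0.
have [J1|J1] := eqVneq J 0.
  by move: total; rewrite J1 mule0 => /eqP; rewrite onee_eq0.
by move: total; rewrite gt0_mulye// lt_neqAle eq_sym J1.
Qed.

End Gamma_marginal.

(** * The gap in one dimension *)

Section one_dimensional_bound.
Context {R : realType}.
Local Notation mu := (@lebesgue_measure R).

Lemma fpoly_ge_sqr m (x : R) : x ^+ 2 <= (fpoly m).[x].
Proof. by rewrite horner_fpoly lerDl -mulnSr exprM exprn_ge0 ?sqr_ge0. Qed.

Lemma fpoly_ge0 m (x : R) : 0 <= (fpoly m).[x].
Proof. exact: le_trans (sqr_ge0 x) (fpoly_ge_sqr m x). Qed.

Lemma measurable_fpoly_weight m (q : {poly R}) alpha (D : set R) :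
  measurable_fun D (fun x => q.[(fpoly m).[x]] * weight alpha x).
Proof.
apply: measurable_funM; last exact: measurable_weight.
under eq_fun do rewrite -horner_comp.
exact: measurable_poly.
Qed.

(** Evaluation gives q <= C I on [0, 1], so the interval [-d, d] carries at most 2 d C I <= I/2;
    outside it f >= x^2 >= d^2. Hence e = d^2/2. *)
Lemma integral_fpoly_gap (alpha : R) m : 0 < alpha < m.+1%:R ->
  exists2 e, 0 < e & forall (q : {poly R}) I, (forall t, 0 <= t -> 0 <= q.[t]) ->
    (\int[mu]_x (q.[(fpoly m).[x]] * weight alpha x)%:E = I%:E)%E ->
    ((e * I)%:E <= \int[mu]_x ((fpoly m).[x] * q.[(fpoly m).[x]] * weight alpha x)%:E)%E.
Proof.
move=> am; have [C C0 hC] := evaluation_le_weight_integral am.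
(* d <= 1/2 keeps f below 1 on [-d, d], and d <= 1/(4 C) gives the half of the mass. *)
pose d := Num.min 2^-1 (4 * C)^-1.
have d0 : 0 < d by rewrite lt_min !invr_gt0 mulr_gt0// andbT.
have d2 : d <= 2^-1 by rewrite ge_min lexx.
have dC : d * (4 * C) <= 1.
  by rewrite -ler_pdivlMr ?mulr_gt0// mul1r ge_min lexx orbT.
exists (d ^+ 2 / 2) => [|q I q0 qI]; first by rewrite divr_gt0// exprn_gt0.
have w0 x : 0 <= weight alpha x by exact: expR_ge0.
have w1 x : weight alpha x <= 1 by rewrite expR_le1 oppr_le0 powR_ge0.
have qw0 x : 0 <= q.[(fpoly m).[x]] * weight alpha x.
  by rewrite mulr_ge0 ?q0 ?fpoly_ge0.
have I0 : 0 <= I.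
  by rewrite -lee_fin -qI; apply: integral_ge0 => x _; rewrite lee_fin.
have qB t : 0 <= t <= 1 -> q.[t] <= C * I.
  by move=> t01; rewrite -lee_fin EFinM -qI; exact: hC.
have fB (x : R) : `|x| <= d -> 0 <= (fpoly m).[x] <= 1.
  move=> xd; rewrite fpoly_ge0/= horner_fpoly.
  have x2 : `|x| <= 2^-1 := le_trans xd d2.
  have h2 : `|x| ^+ 2 <= 2^-1.
    by rewrite (le_trans _ x2)// -[leRHS]expr1 ler_wiXn2l// (le_trans x2)// invf_le1// ler1n.
  have h3 : `|x| ^+ (2 * m + 2) <= `|x| ^+ 2.
    by rewrite ler_wiXn2l ?leq_addl// (le_trans x2)// invf_le1// ler1n.
  rewrite -!normrX !(ger0_norm (sqr_ge0 _)) in h2 h3.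
  rewrite ger0_norm in h3; last by rewrite -mulnSr exprM exprn_ge0 ?sqr_ge0.
  lra.
have pointwise x : d ^+ 2 * (q.[(fpoly m).[x]] * weight alpha x) <=
    (fpoly m).[x] * q.[(fpoly m).[x]] * weight alpha x +
    d ^+ 2 * (C * I) * \1_`[- d, d] x.
  have [xd|xd] := leP `|x| d.
    rewrite indicE mem_set/=; last by rewrite in_itv/= -ler_norml.
    rewrite mulr1; apply: ler_wpDl; first by rewrite !mulr_ge0 ?q0 ?fpoly_ge0.
    apply: ler_wpM2l; first exact: sqr_ge0.
    by rewrite -[leRHS]mulr1; apply: ler_pM; rewrite ?q0 ?fpoly_ge0// qB// fB.
  apply: ler_wpDr; first by rewrite !mulr_ge0 ?(ltW C0) ?(ltW d0) ?indicE.
  rewrite -[leRHS]mulrA; apply: ler_wpM2r => //.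
  rewrite (le_trans _ (fpoly_ge_sqr m x))// -[leRHS]ger0_norm ?sqr_ge0//.
  by rewrite normrX ler_pXn2r ?nnegrE ?(ltW d0)// ltW.
have mfqw : measurable_fun setT
    (fun x => (fpoly m).[x] * q.[(fpoly m).[x]] * weight alpha x).
  apply: measurable_funM; last exact: measurable_weight.
  under eq_fun do rewrite -horner_comp -hornerM.
  exact: measurable_poly.
have : (\int[mu]_x ((d ^+ 2)%:E * (q.[(fpoly m).[x]] * weight alpha x)%:E) <=
   \int[mu]_x (((fpoly m).[x] * q.[(fpoly m).[x]] * weight alpha x)%:E +
     (d ^+ 2 * (C * I))%:E * (\1_`[- d, d] x)%:E))%E.
  apply: ge0_le_integral => //.
  - by move=> x _; rewrite -EFinM lee_fin mulr_ge0 ?sqr_ge0.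
  - by apply: measurable_funeM; apply/measurable_EFinP; exact: measurable_fpoly_weight.
  - apply: emeasurable_funD; first exact/measurable_EFinP.
    by apply: measurable_funeM; apply/measurable_EFinP; exact: measurable_indic.
  - by move=> x _; rewrite -!EFinM -EFinD lee_fin.
have -> : (\int[mu]_x ((d ^+ 2)%:E * (q.[(fpoly m).[x]] * weight alpha x)%:E) =
    (d ^+ 2 * I)%:E)%E.
  rewrite [RHS]EFinM -qI; apply: ge0_integralZl => //.
  - by apply/measurable_EFinP; exact: measurable_fpoly_weight.
  - by move=> x _; rewrite lee_fin.
  - by rewrite lee_fin sqr_ge0.
have mI : measurable_fun setT (fun x : R => (d ^+ 2 * (C * I))%:E * (\1_`[- d, d] x)%:E)%E.
  by apply: measurable_funeM; apply/measurable_EFinP; exact: measurable_indic.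
rewrite ge0_integralD//.
- have -> : (\int[mu]_x ((d ^+ 2 * (C * I))%:E * (\1_`[- d, d] x)%:E) =
      (d ^+ 2 * (C * I) * (2 * d))%:E)%E.
    transitivity ((d ^+ 2 * (C * I))%:E * \int[mu]_x (\1_`[- d, d] x)%:E)%E.
      apply: ge0_integralZl => //.
      - by apply/measurable_EFinP; exact: measurable_indic.
      - by rewrite lee_fin !mulr_ge0 ?(ltW C0) ?(ltW d0).
    rewrite integral_indic// setIT/= lebesgue_measure_itv/= lte_fin.
    by rewrite ifT ?gtrN// -EFinB -EFinM opprK mulr2n mulrDl mul1r.
  move=> h.
  have e1 : (d ^+ 2 / 2 * I)%:E = ((d ^+ 2 * I)%:E - (d ^+ 2 * I / 2)%:E)%E.
    by rewrite -EFinB; congr EFin; field.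
  rewrite e1 leeBlDr// (le_trans h)// leeD2l// lee_fin.
  have -> : d ^+ 2 * (C * I) * (2 * d) = d ^+ 2 * I / 2 * (d * (4 * C)) by field.
  by rewrite ler_piMr// divr_ge0// mulr_ge0 ?sqr_ge0.
- by move=> x _; rewrite lee_fin !mulr_ge0 ?q0 ?fpoly_ge0.
- exact/measurable_EFinP.
- move=> x _; rewrite lee_fin mulr_ge0 ?indicE//.
  by rewrite !mulr_ge0 ?(ltW C0) ?(ltW d0).
Qed.

(** The exponential series beats any power, giving a majorant K/(1 + x^2). This makes the bound at r
    = 0, hence the limit, finite. *)
Lemma integral_fpoly_lty (alpha : R) m : 0 < alpha ->
  (\int[mu]_x ((fpoly m).[x] * weight alpha x)%:E < +oo)%E.
Proof.
move=> a0; pose k := Num.truncn ((2 * m + 4)%:R / alpha).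
have ak : (2 * m + 4)%:R <= alpha * k.+1%:R.
  by rewrite mulrC -ler_pdivrMr// ltW// truncnS_gt.
(* With y = |x| >= 1, (y^2 + y^(2m+2)) (1 + y^2) <= 4 y^(2m+4) <= 4 (k+1)! exp(y^alpha); for y <= 1
   the bound 4 is enough. *)
pose K : R := 4 * (k.+1)`!%:R.
have f1 : (1 : R) <= (k.+1)`!%:R by rewrite ler1n fact_gt0.
have D0 (x : R) : 0 < oneDsqr x by rewrite (lt_le_trans ltr01)// oneDsqr_ge1.
have le1 (x : R) : (fpoly m).[x] * weight alpha x <= K * (oneDsqr x)^-1.
  rewrite ler_pdivlMr// /K.
  have nE : (fpoly m).[x] = `|x| ^+ 2 + `|x| ^+ (2 * m + 2).
    rewrite horner_fpoly -!normrX ger0_norm ?sqr_ge0// ger0_norm//.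
    by rewrite -mulnSr exprM exprn_ge0 ?sqr_ge0.
  have oE : oneDsqr x = 1 + `|x| ^+ 2 by rewrite real_normK// num_real.
  rewrite nE oE /weight; set y := `|x|; have y0 : 0 <= y by rewrite normr_ge0.
  have [y1|y1] := leP y 1.
    have h n : y ^+ n <= 1 by exact: exprn_ile1.
    rewrite (@le_trans _ _ (2 * 1 * 2))//; last lra.
    rewrite ler_pM ?mulr_ge0 ?addr_ge0 ?exprn_ge0 ?expR_ge0//.
      rewrite ler_pM ?mulr_ge0 ?addr_ge0 ?exprn_ge0 ?expR_ge0//.
        by have := h 2; have := h (2 * m + 2)%N; lra.
      by rewrite expR_le1 oppr_le0 powR_ge0.
    by have := h 2; lra.
  have y1' := ltW y1.
  rewrite expRN mulrAC ler_pdivrMr ?expR_gt0//.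
  have He := expR_ge1Dxn k (powR_ge0 y alpha); set e := expR _ in He *.
  have {}He : (y `^ alpha) ^+ k.+1 <= (k.+1)`!%:R * e.
    rewrite mulrC -ler_pdivrMr ?(lt_le_trans ltr01)//.
    by rewrite (le_trans _ He)// lerDr.
  rewrite -mulrA (@le_trans _ _ (4 * y ^+ (2 * m + 4)))//; last first.
    rewrite ler_pM2l// (le_trans _ He)// -powR_mulrn ?powR_ge0// -powRrM.
    by rewrite -powR_mulrn// ler_powR.
  have -> : 4 * y ^+ (2 * m + 4) = (2 * y ^+ (2 * m + 2)) * (2 * y ^+ 2).
    by rewrite (addnA _ 2 2)%N exprD; ring.
  rewrite ler_pM ?addr_ge0 ?exprn_ge0//.
    have := @ler_weXn2l _ y y1' 2 (2 * m + 2)%N; rewrite leq_addl => /(_ isT).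
    lra.
  by have := @exprn_ege1 _ 2 y y1'; lra.
have moneV : measurable_fun setT (fun t : R => (oneDsqr t)^-1).
  by apply: continuous_measurable_fun; exact: continuous_oneDsqrV.
apply: (@le_lt_trans _ _ (\int[mu]_t (K%:E * ((oneDsqr t)^-1)%:E))%E).
  apply: ge0_le_integral => //.
  - by move=> t _; rewrite lee_fin mulr_ge0 ?fpoly_ge0 ?expR_ge0.
  - apply/measurable_EFinP; apply: measurable_funM; last exact: measurable_weight.
    exact: measurable_poly.
  - by apply: measurable_funeM; apply/measurable_EFinP.
  - by move=> t _; rewrite -EFinM lee_fin.
have oneV0 (t : R) : 0 <= (oneDsqr t)^-1 by rewrite invr_ge0 ltW.
rewrite ge0_integralZl//; [|exact/measurable_EFinP|by rewrite lee_fin mulr_ge0].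
rewrite ge0_symfun_integralT//; last 2 first.
- exact: continuous_oneDsqrV.
- by move=> t /=; rewrite /oneDsqr sqrrN.
rewrite (_ : [set x | _] = `[0%R, +oo[%classic); last first.
  by apply/seteqP; split => x /=; rewrite in_itv/= andbT.
by rewrite integral0y_oneDsqr -!EFinM ltry.
Qed.

End one_dimensional_bound.

(** * The gap for the push-forward bounds *)

Section gap.
Context {R : realType}.
Local Notation mu := (@lebesgue_measure R).

Lemma sos_ge0 r (s : {poly R}) (t : R) : sos r s -> 0 <= s.[t].
Proof.
move=> [ps [_ ->]]; rewrite horner_sum sumr_ge0// => p _.
by rewrite horner_exp sqr_ge0.
Qed.

Lemma sos1 r : sos r (1 : {poly R}).
Proof.
exists [:: 1]; split; first by rewrite /= size_poly1.
by rewrite big_seq1 expr1n.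
Qed.

Lemma sos_subset r r' : (r <= r')%N -> @sos R r `<=` sos r'.
Proof.
move=> rr s [ps [aps ->]]; exists ps; split => //.
by apply: sub_all aps => p /leq_trans; apply.
Qed.

Lemma ub_push_nonincreasing n (f : mpoly.mpoly n R) nu :
  nonincreasing_seq (ub_push f nu).
Proof.
move=> r r' rr; apply: ereal_inf_le_tmp => _ [s [ss s1] <-].
by exists s => //; split => //; exact: sos_subset ss.
Qed.

(** The bounds are nonincreasing in r, all at least e > 0, and finite at r = 0, so they converge to
    a real limit at least e, while the minimum is 0. *)
Lemma ub_push_fpoly_gap (alpha : R) m k (f : mpoly.mpoly k.+1 R) :
  0 < alpha < m.+1%:R ->
  (forall x, mpoly_fun f x = (fpoly m).[thead x]) ->
  exists fmin l : R, [/\ is_minimum (mpoly_fun f) fmin,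
      ub_push f (Gamma alpha (n := k.+1)) r @[r --> \oo] --> l%:E
    & fmin < l].
Proof.
move=> am fE; have /andP[a0 _] := am.
have [c c0 marg] := Gamma_marginal k a0.
have [e e0 gap] := integral_fpoly_gap am.
pose nu : {measure set (Rn R k.+1) -> \bar R} := Gamma alpha (n := k.+1).
have lower r : (e%:E <= ub_push f nu r)%E.
  apply: le_ereal_inf_tmp => _ [s [ss s1] <-].
  have s0 t : 0 <= t -> 0 <= s.[t] by move=> _; exact: sos_ge0 ss.
  (* The normalization under the unnormalized weight; the factor c cancels when returning to
     [Gamma]. *)
  have I1 : (\int[mu]_x (s.[(fpoly m).[x]] * weight alpha x)%:E = (c^-1)%:E)%E.
    have := marg (fun t => s.[(fpoly m).[t]]) _ (fun t => s0 _ (fpoly_ge0 m t)).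
    move: s1; under eq_integral do rewrite fE.
    move=> -> /(_ _)-h.
    have {}h : 1%E = (c%:E * \int[mu]_x (s.[(fpoly m).[x]] * weight alpha x)%:E)%E.
      apply: h; under eq_fun do rewrite -horner_comp.
      exact: measurable_poly.
    have := congr1 (fun z => (c^-1)%:E * z)%E h.
    by rewrite mule1 muleA -EFinM mulVf ?gt_eqF// mul1e => ->.
  have := gap s _ s0 I1.
  under [in X in _ -> X]eq_integral do rewrite fE.
  rewrite (marg (fun t => (fpoly m).[t] * s.[(fpoly m).[t]])); last 2 first.
  - under eq_fun do rewrite -horner_comp -hornerM.
    exact: measurable_poly.
  - by move=> t; rewrite mulr_ge0 ?s0 ?fpoly_ge0.
  move=> /(lee_wpmul2l (_ : 0 <= c%:E)%E) -/(_ _)-h.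
  apply: le_trans (h _); last by rewrite lee_fin ltW.
  by rewrite -EFinM lee_fin mulrCA mulfV ?mulr1// gt_eqF.
have upper : (ub_push f nu 0 < +oo)%E.
  (* The constant s = 1 is feasible since [Gamma] has mass 1. *)
  apply: (@le_lt_trans _ _ (\int[nu]_x (mpoly_fun f x * (1 : {poly R}).[mpoly_fun f x])%:E)%E).
    apply: ge_ereal_inf; eexists; last exact: lexx.
    exists 1 => //; split; first exact: sos1.
    transitivity (\int[nu]_x (cst 1 x))%E.
      by apply: eq_integral => x _; rewrite hornerC.
    by rewrite integral_cst// mul1e; exact: Gamma_setT.
  under eq_integral do rewrite hornerC mulr1 fE.
  rewrite (marg (fun t => (fpoly m).[t])).
  - by rewrite lte_mul_pinfty ?lee_fin ?(ltW c0)// integral_fpoly_lty.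
  - exact: measurable_poly.
  - by move=> t; exact: fpoly_ge0.
have cvg := ereal_nonincreasing_cvgn (@ub_push_nonincreasing k.+1 f nu).
set L := ereal_inf _ in cvg.
have Le : (e%:E <= L)%E by apply: le_ereal_inf_tmp => _ [r _ <-].
have Ly : (L < +oo)%E.
  by apply: le_lt_trans upper; apply: ereal_inf_lbound; exists 0%N.
have Lfin : L \is a fin_num by rewrite fin_numElt Ly (lt_le_trans _ Le)// ltNyr.
exists 0, (fine L); split.
- split; last by move=> x; rewrite fE fpoly_ge0.
  exists [tuple of 0 :: nseq k 0]; rewrite fE theadE horner_fpoly.
  by rewrite addn2 !expr0n addr0.
- by rewrite fineK.
- by rewrite -lte_fin fineK// (lt_le_trans _ Le)// lte_fin.
Qed.

(** Only the first coordinate enters, so one univariate polynomial serves every dimension. *)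
Lemma mpoly_fun_fpoly k m (x : Rn R k.+1) :
  let X : mpoly.mpoly k.+1 R := mpoly.mpolyX R (mpoly.mnm1 ord0) in
  mpoly_fun (X ^+ 2 + X ^+ (2 * m + 2)) x = (fpoly m).[thead x].
Proof.
by rewrite /mpoly_fun mpoly.mevalD !rmorphXn/= mpoly.mevalXU horner_fpoly.
Qed.

End gap.

Unset Implicit Arguments.

Theorem theorem7 (R : realType) (alpha : R) (halpha : 0 < alpha) :
  (forall n : nat, (1 <= n)%N ->
    exists (f : mpoly.mpoly n R) (fmin l : R),
      [/\ is_minimum (mpoly_fun f) fmin,
          ub_push f (Gamma alpha (n := n)) r @[r --> \oo] --> l%:E
        & fmin < l]) /\
  (let x : mpoly.mpoly 1 R := mpoly.mpolyX R (mpoly.mnm1 ord0) in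
   let f : mpoly.mpoly 1 R := x ^+ 2 + x ^+ (2 * `|Num.ceil alpha| + 2)%N in
   exists fmin l : R,
      [/\ is_minimum (mpoly_fun f) fmin,
          ub_push f (Gamma alpha (n := 1)) r @[r --> \oo] --> l%:E
        & fmin < l]).
Proof.
(* Since alpha > 0 the absolute value only turns the ceiling into a natural number; alpha <= m < m +
   1 is the strict inequality that makes the tail heavy. *)
set m := `|Num.ceil alpha|%N.
have am : 0 < alpha < m.+1%:R.
  rewrite halpha/= -natr1 (le_lt_trans (ceil_ge alpha))//.
  by rewrite ltr_pwDr// natr_absz ler_int ler_norm.
split=> [[//|k] _|/=].
  eexists; apply: (@ub_push_fpoly_gap R alpha m k _ am) => x.
  exact: mpoly_fun_fpoly.
by apply: (@ub_push_fpoly_gap R alpha m 0 _ am) => x; exact: mpoly_fun_fpoly.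
Qed.
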